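(* Let $n>1$, let $(X,\|\cdot\|)$ and $(X^n,|\!|\!|\cdot|\!|\!|)$ be Asplund spaces such that, for some $\kappa>0$, $|\!|\!|(u_1,\ldots,u_n)|\!|\!|\le\kappa\max_{1\le i\le n}\|u_i\|$ for all $u_1,\ldots,u_n\in X$. Let $\Omega_1,\ldots,\Omega_n$ be nonempty subsets of $X$ such that $\widehat\Omega:=\Omega_1\times\ldots\times\Omega_n$ is closed, and let $\bar x\in\bigcap_{i=1}^n\Omega_i$. The collection $\{\Omega_1,\ldots,\Omega_n\}$ is transversal at $\bar x$ if and only if there exist $\alpha>0$ and $\varepsilon>0$ such that $$\Big\|\sum_{i=1}^nx_i^*\Big\|>\alpha$$ for all $\hat x:=(x_1,\ldots,x_n)\in\widehat\Omega$ and $\hat x^*:=(x_1^*,\ldots,x_n^* )\in N^F_{\widehat\Omega}(\hat x)$ satisfying $|\!|\!|(x_1-\bar x,\ldots,x_n-\bar x)|\!|\!|<\varepsilon$ and $|\!|\!|\hat x^*|\!|\!|=1$.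
   Context: Transversality: given $\alpha>0$, the collection $\{\Omega_1,\ldots,\Omega_n\}$ is $\alpha$-transversal at $\bar x\in\bigcap_{i=1}^n\Omega_i$ if there exists an $\varepsilon>0$ such that $\bigcap_{i=1}^n(\Omega_i-x_i-a_i)\cap(\rho\mathbb B)\ne\emptyset$ for all $\rho\in(0,\varepsilon)$, $x_i\in\Omega_i$ and $a_i\in X$ $(i=1,\ldots,n)$ satisfying $|\!|\!|(x_1-\bar x,\ldots,x_n-\bar x)|\!|\!|<\varepsilon$ and $|\!|\!|(a_1,\ldots,a_n)|\!|\!|<\alpha\rho$. It is transversal at $\bar x$ if it is $\alpha$-transversal at $\bar x$ for some $\alpha>0$. Here $\mathbb B$ is the open unit ball of $(X,\|\cdot\|)$. Duality. $X^*$ is the topological dual of $(X,\|\cdot\|)$. Continuous linear functionals on $(X^n,|\!|\!|\cdot|\!|\!|)$ are regarded as tuples $\hat x^*=(x_1^*,\ldots,x_n^* )$ with $x_i^*\in X^*$, acting by $\langle\hat x^*,(u_1,\ldots,u_n)\rangle=\sum_{i=1}^n\langle x_i^*,u_i\rangle$. Dual norms are denoted by the same symbols as the primal ones. The Fréchet normal cone to a subset $\Omega$ of a normed space $(Y,\|\cdot\|)$ at $\bar y\in\Omega$ is $$N^F_\Omega(\bar y):=\Big\{y^*\in Y^*\ \Big|\ \limsup_{\Omega\ni y\to\bar y,\,y\ne\bar y}\frac{\langle y^*,y-\bar y\rangle}{\|y-\bar y\|}\le0\Big\};$$ here it (and closedness of $\widehat\Omega$) is taken with respect to $Y=(X^n,|\!|\!|\cdot|\!|\!|)$.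 A Banach space is Asplund if every continuous convex function on an open convex set is Fréchet differentiable on a dense subset of that set. *)

(* Defs.v *)
From HB Require Import structures.
From mathcomp Require Import all_boot all_order all_algebra.
From mathcomp Require Import all_classical all_reals all_analysis.

Set Implicit Arguments.
Unset Strict Implicit.
Unset Printing Implicit Defensive.

Import Order.TTheory GRing.Theory Num.Theory.
Import numFieldNormedType.Exports.

Local Open Scope classical_set_scope.
Local Open Scope ring_scope.

Record norm_on (R : realType) (V : lmodType R) := NormOn {
  norm_fun :> V -> R ;
  norm_onD : forall u v, norm_fun (u + v) <= norm_fun u + norm_fun v ;
  norm_onZ : forall (k : R) u, norm_fun (k *: u) = `|k| * norm_fun u ;
  norm_on0_eq0 : forall u, norm_fun u = 0 -> u = 0
}.

(* The normed space (V, N). The alias carries the topology of N, whatever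
   topology V itself may have: on V = ('I_n -> X) the library would otherwise
   infer that of pointwise convergence. *)
Definition normed_by (R : realType) (V : lmodType R) (N : norm_on V) : Type :=
  V.

Section normed_by_instances.
Variables (R : realType) (V : lmodType R) (N : norm_on V).

HB.instance Definition _ := GRing.Lmodule.on (normed_by N).
HB.instance Definition _ := Lmodule_isNormed.Build R (normed_by N)
  (norm_onD N) (norm_onZ N) (@norm_on0_eq0 R V N).

Lemma normed_byE (u : normed_by N) : `|u| = N u.
Proof. by []. Qed.

End normed_by_instances.

Definition banach (R : realType) (E : normedModType R) :=
  forall F : set_system E, ProperFilter F -> cauchy F -> cvg F.

(* A function on D is given by a total function of which only the values on D
   matter: D is open, so differentiability at a point of D is local to D. *)
Definition asplund (R : realType) (E : normedModType R) :=
  banach E /\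
  forall (D : set E) (f : E -> R^o),
    open D -> convex_set D ->
    {within D, continuous f} -> convex_function D f ->
    D `<=` closure [set x | D x /\ differentiable f x].

Definition dual_space (R : realType) (E : normedModType R) : set (E -> R) :=
  [set f : E -> R | scalar f /\ continuous f].

(* Only meaningful on dual_space E: the set is then bounded, so sup is not a
   default value. *)
Definition dual_norm (R : realType) (E : normedModType R) (f : E -> R) : R :=
  sup [set `|f x| | x in [set x : E | `|x| <= 1]].

(* When y is isolated in Om the filter contains set0 and the upper limit is
   -oo, so that the cone is the whole dual space. *)
Definition frechet_normal (R : realType) (E : normedModType R)
    (Om : set E) (y : E) : set (E -> R) :=
  [set f | dual_space f /\
     (limf_esup (fun z : E => (f (z - y) / `|z - y|)%:E) (within Om y^')
        <= 0)%E].

Definition prod_set (n : nat) (T : Type) (Om : 'I_n -> set T) :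
    set ('I_n -> T) :=
  [set x | forall i, Om i (x i)].

Definition tuple_functional (R : realType) (n : nat) (X : normedModType R)
    (xs : 'I_n -> X -> R) : ('I_n -> X) -> R :=
  fun u => \sum_(i < n) xs i (u i).

Definition alpha_transversal (R : realType) (n : nat) (X : normedModType R)
    (N : norm_on ('I_n -> X)) (Om : 'I_n -> set X) (xbar : X) (alpha : R) :=
  exists2 eps : R, 0 < eps &
    forall (rho : R) (x a : 'I_n -> X),
      0 < rho < eps ->
      (forall i, Om i (x i)) ->
      N (fun i => x i - xbar) < eps ->
      N a < alpha * rho ->
      (\bigcap_(i in [set: 'I_n]) [set w - x i - a i | w in Om i])
        `&` ball (0 : X) rho !=set0.

Definition transversal_at (R : realType) (n : nat) (X : normedModType R)
    (N : norm_on ('I_n -> X)) (Om : 'I_n -> set X) (xbar : X) :=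
  exists2 alpha : R, 0 < alpha & alpha_transversal N Om xbar alpha.

(* Main.v *)
Require Import Defs.
From HB Require Import structures.
From mathcomp Require Import all_boot all_order all_algebra.
From mathcomp Require Import all_classical all_reals all_analysis.
From mathcomp Require Import ring lra.

Set Implicit Arguments.
Unset Strict Implicit.
Unset Printing Implicit Defensive.

Import Order.TTheory GRing.Theory Num.Theory.
Import numFieldNormedType.Exports.

Local Open Scope classical_set_scope.
Local Open Scope ring_scope.

(** Necessity.  Let [f], of norm 1, be a Frechet normal to the product set at
  [x], with components [xs i].  Transversality provides, for every small [a], a
  vector [w] of comparable size such that [x + a + (w, ..., w)] is in the
  product set.  Take [a] where [f] nearly attains its norm: since [f] is
  almost nonpositive on [a + (w, ..., w)], the sum of the [xs i] must be
  very negative at [w], hence has a large norm ([transversal_dual_ineq]).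

  Sufficiency.  Assume that no [b + (v, ..., v)] with [v] of norm below [rho]
  is in the product set, where [b = x + a] is close to a point [x] of it.
  On the product space put the norm
  [G y = inf_u (N (y - (u, ..., u)) + al * `|u|)] ([tilted_norm]), whose
  dual ball consists of the functionals of [N]-norm at most 1 whose
  components have a sum of norm at most [al].  The theorem [norming_normal],
  valid in every Asplund space, gives a point [y] of the product set, about
  as close to [b] as [x] is, and a Frechet normal at [y] in the dual ball of
  [G] that nearly attains [G (b - y)].  Decompose [y - b] as
  [r + (u, ..., u)], nearly optimally for [G].  If [r] is not much smaller
  than [x - b], the normal has [N]-norm at least 1/2 and contradicts the dual
  inequality ([small_sum_normal]).  Otherwise [y] is much closer to the new
  centre [b + (u, ..., u)] than [x] was to [b] ([recentering_step]).
  Iterating, the points and the centres converge to one limit, which is of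
  the excluded form ([transversal_core]).

  The theorem [norming_normal] is the analytic core.  The Asplund property is
  used through the density of points of Frechet differentiability of convex
  1-Lipschitz functions ([frechet_dense]).  Measured on a countable
  set only, the dual ball is then norm separable ([dual_ball_small]).  This
  makes it possible to approximate the norm uniformly by convex functions that are
  Frechet differentiable in all directions of the closure of the countable
  set ([smooth_norm_frechet]).  A variational principle with these functions
  as perturbations ([borwein_preiss]) yields exact Frechet normals to a
  closed set whose differences lie in that closure ([separable_normal]).  The
  general case is reduced to this one.  That no functional of the required
  kind is normal at a point has a finite witness, by compactness
  of the dual ball ([finite_failure]); and if a countable set is closed under
  the choice of such witnesses, the points of the given set in its closure
  form a part whose normals pass all the tests made by the witnesses. *)

(** * Norms and linear functionals *)

Section NormFacts.
Variables (R : realType) (V : lmodType R) (G : norm_on V).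
Implicit Types (u v w : V).

Lemma norm_on0 : G 0 = 0.
Proof. by rewrite -(scale0r (0 : V)) norm_onZ normr0 mul0r. Qed.

Lemma norm_onN v : G (- v) = G v.
Proof. by rewrite -scaleN1r norm_onZ normrN normr1 mul1r. Qed.

Lemma norm_on_ge0 v : 0 <= G v.
Proof. have := norm_onD G v (- v); rewrite subrr norm_on0 norm_onN; lra. Qed.

Lemma norm_onBC u v : G (u - v) = G (v - u).
Proof. by rewrite -norm_onN opprB. Qed.

Lemma norm_on_tri w u v : G (u - v) <= G (u - w) + G (w - v).
Proof. by rewrite -[u - v](subrKA w) norm_onD. Qed.

Lemma norm_onB u v : G u <= G v + G (u - v).
Proof. by rewrite -{1}(subrKC v u) norm_onD. Qed.

Lemma norm_onZp (t : R) v : 0 <= t -> G (t *: v) = t * G v.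
Proof. by move=> t0; rewrite norm_onZ ger0_norm. Qed.

End NormFacts.

Section ScalarFacts.
Variables (R : realType) (V : lmodType R) (f : V -> R).
Hypothesis lf : scalar f.

Lemma linfD u v : f (u + v) = f u + f v.
Proof. by have := lf 1 u v; rewrite scale1r mul1r. Qed.

Lemma linf0 : f 0 = 0.
Proof. have := linfD 0 0; rewrite addr0; lra. Qed.

Lemma linfZ a u : f (a *: u) = a * f u.
Proof. by have := lf a u 0; rewrite !addr0 linf0 addr0. Qed.

Lemma linfN u : f (- u) = - f u.
Proof. by rewrite -scaleN1r linfZ mulN1r. Qed.

Lemma linfB u v : f (u - v) = f u - f v.
Proof. by rewrite linfD linfN. Qed.

End ScalarFacts.

Section DualBall.
Variables (R : realType) (V : lmodType R) (G : norm_on V).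

Definition dual_ball : set (V -> R) :=
  [set f | scalar f /\ forall v, f v <= G v].

Lemma dual_ballN f v : dual_ball f -> - G v <= f v.
Proof. by case=> lf fG; rewrite lerNl -(linfN lf) -(norm_onN G). Qed.

Lemma dual_ball0 : dual_ball (fun=> 0).
Proof. by split=> [a u v|v]; [rewrite mulr0 addr0|exact: norm_on_ge0]. Qed.

Lemma dual_ball_mid f g : dual_ball f -> dual_ball g ->
  dual_ball (fun v => 2^-1 * (f v + g v)).
Proof.
move=> [lf fG] [lg gG]; split=> [a u v|v]; first by rewrite lf lg; ring.
have := fG v; have := gG v; lra.
Qed.

End DualBall.

(** Banach-Alaoglu in the form used below: an ultrafilter on any index set
  turns a family in the dual ball into one of its pointwise cluster points. *)
Section UltraLimit.
Variables (R : realType) (T : Type) (U : set_system T).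
Hypothesis UU : UltraFilter U.

Definition ultra_lim (f : T -> R) : R := sup [set r | U [set t | r < f t]].

Lemma ultra_limP (f : T -> R) (M e : R) : (forall t, `|f t| <= M) -> 0 < e ->
  U [set t | `|f t - ultra_lim f| < e].
Proof.
move=> fM e0; pose S := [set r | U [set t | r < f t]].
have S0 : S !=set0.
  exists (- M - 1); apply: filterS filterT => t _ /=.
  by have := fM t; rewrite ler_norml => /andP[]; lra.
have Sub : has_ubound S.
  exists M => r /filter_ex[t /= rf].
  by have := fM t; rewrite ler_norml => /andP[]; lra.
have U1 : U [set t | ultra_lim f - e < f t].
  have [r Sr rs] := sup_adherent e0 (conj S0 Sub).
  by apply: filterS Sr => t /=; move: rs; rewrite -/(ultra_lim f); lra.
have U2 : U (~` [set t | ultra_lim f + e / 2 < f t]).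
  have [h|//] := in_ultra_setVsetC [set t | ultra_lim f + e / 2 < f t] UU.
  have := ub_le_sup Sub h; rewrite -/(ultra_lim f); lra.
apply: filterS (filterI U1 U2) => t /= [h1 /negP]; rewrite -leNgt => h2.
rewrite ltr_norml; lra.
Qed.

Lemma ultra_lim_eq (f : T -> R) (M l : R) : (forall t, `|f t| <= M) ->
  (forall e, 0 < e -> U [set t | `|f t - l| < e]) -> ultra_lim f = l.
Proof.
move=> fM fl; apply/eqP/contraT => nl.
have e0 : 0 < `|ultra_lim f - l| / 2 by rewrite divr_gt0// normr_gt0 subr_eq0.
have [t /= []] := filter_ex (filterI (ultra_limP fM e0) (fl _ e0)).
rewrite distrC => h1 h2.
have := ler_normD (ultra_lim f - f t) (f t - l); rewrite subrKA; lra.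
Qed.

Variables (V : lmodType R) (G : norm_on V).

Lemma dual_ball_ultra_lim (a : T -> V -> R) : (forall t, dual_ball G (a t)) ->
  exists2 y, dual_ball G y &
    forall v e, 0 < e -> U [set t | `|a t v - y v| < e].
Proof.
move=> aB.
have aM v t : `|a t v| <= G v.
  by rewrite ler_norml (dual_ballN _ (aB t)) /=; case: (aB t).
exists (fun v => ultra_lim (a ^~ v)) => [|v e e0]; last exact: ultra_limP.
split=> [k u v|v].
  apply: (@ultra_lim_eq _ (G (k *: u + v))) => // e e0.
  have e1 : 0 < e / 2 / (`|k| + 1).
    by rewrite !divr_gt0// ltr_wpDl.
  have e2 : 0 < e / 2 by lra.
  apply: filterS (filterI (ultra_limP (aM u) e1) (ultra_limP (aM v) e2)).
  move=> t /= [h1 h2]; have [-> _] := aB t.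
  rewrite opprD addrACA -mulrBr; apply: le_lt_trans (ler_normD _ _) _.
  rewrite normrM.
  suff : `|k| * `|a t u - ultra_lim (a^~ u)| <= e / 2 by lra.
  apply: le_trans (_ : (`|k| + 1) * (e / 2 / (`|k| + 1)) <= _).
    by apply: ler_pM => //; [rewrite lerDl | exact: ltW].
  by rewrite mulrC divfK// gt_eqF// ltr_wpDl.
apply/ler_addgt0Pr => e e0.
have [t /=] := filter_ex (ultra_limP (aM v) e0).
have [_ /(_ v)] := aB t; rewrite ltr_norml => h /andP[]; lra.
Qed.

End UltraLimit.

(** * Separability of the dual on countable sets *)

Section Asplund.
Variables (R : realType) (V : lmodType R) (G : norm_on V).

Definition frechet_deriv (p : V -> R) (x : V) (f : V -> R) :=
  forall e, 0 < e -> exists2 d, 0 < d &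
    forall h, G h < d -> `|p (x + h) - p x - f h| <= e * G h.

Definition frechet_dense := forall p : V -> R,
  (forall x y (t : R), 0 <= t <= 1 ->
     p (t *: x + (1 - t) *: y) <= t * p x + (1 - t) * p y) ->
  (forall x y, p x - p y <= G (x - y)) ->
  forall (x : V) e, 0 < e -> exists2 y, G (y - x) < e &
    exists2 f, scalar f & frechet_deriv p y f.

Lemma frechet_deriv_dir p x f v e : frechet_deriv p x f -> scalar f -> 0 < e ->
  exists2 t, 0 < t <= 1 & `|p (x + t *: v) - p x - t * f v| <= t * e.
Proof.
move=> pf lf e0; have g0 := norm_on_ge0 G v.
have e1 : 0 < e / (G v + 1) by rewrite divr_gt0// ltr_wpDl.
have [d d0 dP] := pf _ e1.
pose t := Num.min 1 (d / 2 / (G v + 1)).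
have t0 : 0 < t by rewrite lt_min ltr01 !divr_gt0// ltr_wpDl.
exists t; first by rewrite t0 ge_min lexx.
have tG : t * (G v + 1) <= d / 2 by rewrite -ler_pdivlMr ?ltr_wpDl// ge_min lexx orbT.
have := dP (t *: v); rewrite norm_onZp ?(ltW t0)// (linfZ lf).
move=> /(_ ltac:(nra)) /le_trans; apply.
rewrite mulrCA ler_wpM2l ?(ltW t0)// -mulrA ger_pMr//.
by rewrite mulrC ler_pdivrMr ?mul1r ?lerDl ?ltr_wpDl.
Qed.

Hypothesis AG : frechet_dense.

(** A derivative of the norm at [y] lies in the dual ball and norms [y]; such
  points [y] being dense, the dual ball norms every vector. *)
Lemma dual_ball_norming x e : 0 < e -> exists2 f, dual_ball G f & G x - e < f x.
Proof.
move=> e0.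
have [|||y yx [f lf yf]] := AG (p := G) _ _ x (e := e / 2).
- move=> u v t /andP[t0 t1]; apply: le_trans (norm_onD _ _ _) _.
  by rewrite !norm_onZp// subr_ge0.
- by move=> u v; rewrite lerBlDl norm_onB.
- by lra.
have fG v : f v <= G v.
  apply/ler_addgt0Pr => a a0.
  have [t /andP[t0 _]] := frechet_deriv_dir v yf lf a0.
  rewrite ler_norml => /andP[+ _].
  have := norm_onD G y (t *: v); rewrite (norm_onZp _ _ (ltW t0)) => h1 h2.
  rewrite -(ler_pM2l t0); lra.
exists f => //.
have fy : G y <= f y.
  apply/ler_addgt0Pr => a a0.
  have [t /andP[t0 t1]] := frechet_deriv_dir (- y) yf lf a0.
  rewrite (linfN lf) scalerN -{1}[y]scale1r -scalerBl norm_onZp ?subr_ge0//.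
  rewrite ler_norml => /andP[+ _] => h.
  rewrite -(ler_pM2l t0); lra.
have := norm_on_tri G y x 0; rewrite !subr0 (norm_onBC G x).
have := fG (y - x); rewrite (linfB lf); lra.
Qed.

Variable z : nat -> V.

(** Smallness is the sigma-ideal of the sets of functionals covered by
  countably many sets of diameter at most [e], distances being measured on
  the range of [z] only; [code] numbers the pieces of the cover. *)
Definition small (e : R) (A : set (V -> R)) :=
  exists code : (V -> R) -> nat, forall a b, A a -> A b -> code a = code b ->
    forall j, a (z j) - b (z j) <= e * G (z j).

Lemma small_sub e A B : A `<=` B -> small e B -> small e A.
Proof. by move=> AB [c cP]; exists c => a b /AB Ba /AB Bb; exact: cP. Qed.

Lemma small_bigcup e (I : countType) (A : I -> set (V -> R)) :
  (forall i, small e (A i)) -> small e (\bigcup_i A i).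
Proof.
move=> /choice[c cP].
have /choice[k kP] : forall a, exists k : option I,
    (\bigcup_i A i) a -> exists2 i, k = Some i & A i a.
  move=> a; have [[i _ Aia]|na] := pselect ((\bigcup_i A i) a).
    by exists (Some i) => _; exists i.
  by exists None => /na.
exists (fun a => if k a is Some i then pickle (i, c i a) else 0%N).
move=> a b /kP[i -> Aa] /kP[j -> Ab].
move=> /(pcan_inj pickleK)[ij]; rewrite -ij in Ab *.
exact: cP.
Qed.

Lemma small_setU e A B : small e A -> small e B -> small e (A `|` B).
Proof.
move=> sA sB; apply: small_sub (small_bigcup (A := fun b : bool => if b then A else B) _).
  by move=> a [Aa|Ba]; [exists true|exists false].
by case.
Qed.

Lemma small0 e : small e set0. Proof. by exists (fun=> 0%N) => a b []. Qed.

(** Discarding from [A] its countably many small cuts by rational levels at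
  the [z j] leaves a set that still has two members far apart at some
  [z j]; any rational level between their values splits [A] as claimed. *)
Lemma not_small_split e A : 0 < e -> A `<=` dual_ball G -> ~ small e A ->
  exists j q,
  ~ small e (A `&` [set a | q + e / 2 * G (z j) < a (z j)]) /\
  ~ small e (A `&` [set a | a (z j) < q]).
Proof.
move=> e0 AB nA.
pose cut (i : nat * rat * bool) := let: (j, q, b) := i in
  if b then A `&` [set a | ratr q + e / 2 * G (z j) < a (z j)]
  else A `&` [set a | a (z j) < ratr q].
pose bad (i : nat * rat * bool) := [set a | small e (cut i) /\ cut i a].
have sbad : small e (\bigcup_i bad i).
  apply: small_bigcup => i; have [s|ns] := pselect (small e (cut i)).
    by apply: small_sub s => a [].
  by apply: small_sub (small0 e) => a [/ns].
have : ~ small e (A `\` \bigcup_i bad i).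
  move=> s; apply: nA; apply: small_sub (small_setU s sbad).
  by move=> a Aa; have [|n] := pselect ((\bigcup_i bad i) a); [right|left].
move=> nA'.
have [a [b [j [[Aa na] [Ab nb] ab]]]] : exists a b j,
    [/\ (A `\` \bigcup_i bad i) a, (A `\` \bigcup_i bad i) b &
        e * G (z j) < a (z j) - b (z j)].
  apply: contrapT => h; apply: nA'; exists (fun=> 0%N) => a b Aa Ab _ j.
  by rewrite leNgt; apply/negP => abj; apply: h; exists a, b, j.
have Gz : 0 < G (z j).
  rewrite lt_neqAle norm_on_ge0 andbT eq_sym; apply/negP => /eqP G0.
  move: ab; rewrite G0 (norm_on0_eq0 G0).
  have [la _] := AB _ Aa; have [lb _] := AB _ Ab.
  by rewrite (linf0 la) (linf0 lb) mulr0 subrr ltxx.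
have [q] : exists q : rat, ratr q \in `]b (z j), a (z j) - e / 2 * G (z j)[.
  by apply: rat_in_itvoo; nra.
rewrite in_itv/= => /andP[bq qa].
exists j, (ratr q); split => s.
  apply: na; exists (j, q, true) => //; split => //; split => //=; lra.
by apply: nb; exists (j, q, false).
Qed.

(** An essential supremum over the dual ball, the small sets playing the part
  of the null sets. *)
Definition sup_mod_small (e : R) (x : V) :=
  sup [set r | ~ small e (dual_ball G `&` [set a | r < a x])].

(** If the dual ball were not small, [sup_mod_small] would be a convex
  1-Lipschitz function without any point of Frechet differentiability: the
  functionals nearly attaining it at [y] form a set that is not small, which
  splits with a gap along some [z j], so that the slopes at [y] in the
  directions [z j] and [- z j] add up to a fixed positive amount, at every
  scale. *)
Lemma dual_ball_small e : 0 < e -> small e (dual_ball G).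
Proof.
move=> e0; apply: contrapT => nB; pose p := sup_mod_small e.
have ubS x : ubound [set r | ~ small e (dual_ball G `&` [set a | r < a x])] (G x).
  move=> r /= nr; rewrite leNgt; apply/negP => Gr; apply: nr.
  apply: small_sub (small0 e) => a [[_ /(_ x) h]] /= /lt_trans/(_ (le_lt_trans h Gr)).
  by rewrite ltxx.
have hS x : has_sup [set r | ~ small e (dual_ball G `&` [set a | r < a x])].
  split; last by exists (G x); exact: ubS.
  exists (- G x - 1) => s; apply: nB; apply: small_sub s => a Ba; split => //=.
  have := dual_ballN x Ba; lra.
have ltp x r : r < p x -> ~ small e (dual_ball G `&` [set a | r < a x]).
  move=> rp; have /sup_adherent/(_ (hS x))[s /= ns rs] : 0 < p x - r by lra.
  apply: contra_not ns; apply: small_sub => a [Ba /= h]; split => //=.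
  by move: rs; rewrite (_ : sup _ = p x)//; lra.
have ple x r : ~ small e (dual_ball G `&` [set a | r < a x]) -> r <= p x.
  by move=> h; apply: ub_le_sup => //; exact: (hS x).2.
have gtp x r : p x < r -> small e (dual_ball G `&` [set a | r < a x]).
  by move=> pr; apply: contrapT => /ple; lra.
have [|||y _ [f lf yf]] := AG (p := p) _ _ 0 (e := 1).
- move=> x y t /andP[t0 t1]; apply/ler_addgt0Pr => b b0.
  rewrite leNgt; apply/negP => /ltp; apply.
  apply: small_sub (small_setU (gtp x (p x + b) _) (gtp y (p y + b) _)); [|lra..].
  move=> a [Ba /=]; have [la _] := Ba.
  rewrite la (linfZ la) => h.
  have [hx|hx] := ltP (p x + b) (a x); first by left.
  right; split => //=; rewrite ltNge; apply/negP => hy.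
  have t1' : 0 <= 1 - t by lra.
  have := ler_wpM2l t0 hx; have := ler_wpM2l t1' hy; lra.
- move=> x y; rewrite lerBlDr; apply/ler_addgt0Pr => b b0.
  rewrite leNgt; apply/negP => /ltp; apply.
  apply: small_sub (gtp y (p y + b) _); last by lra.
  move=> a [Ba /=]; have [la /(_ (x - y))] := Ba.
  rewrite (linfB la) => h1 h2; split => //=; lra.
- by [].
have [d d0 dP] := yf (e / 16) ltac:(lra).
(* The loss [eta] must be small against the gap [e / 2] at the scale [d / 2]
   of the increments; the split is chosen after both. *)
pose eta := e * d / 64.
have eta0 : 0 < eta by rewrite !mulr_gt0.
have [||j [q [n1 n2]]] := not_small_split e0 _ (ltp y (p y - eta) _).
- by move=> a [].
- lra.
have Gz : 0 < G (z j).
  rewrite lt_neqAle norm_on_ge0 andbT eq_sym; apply/negP => /eqP G0.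
  have z0 := norm_on0_eq0 G0; have [q0|q0] := leP 0 q.
    apply: n1; apply: small_sub (small0 e) => a [[[la _] _]] /=.
    by rewrite z0 norm_on0 (linf0 la); lra.
  apply: n2; apply: small_sub (small0 e) => a [[[la _] _]] /=.
  by rewrite z0 (linf0 la); lra.
pose t := d / 2 / G (z j).
have t0 : 0 < t by rewrite !divr_gt0.
have tG : t * G (z j) = d / 2 by rewrite divfK// gt_eqF.
have h1 : p y - eta + t * (q + e / 2 * G (z j)) <= p (y + t *: z j).
  apply: ple; apply: contra_not n1; apply: small_sub => a [[Ba /= ha] /= hz].
  split => //=; have [la _] := Ba; rewrite (linfD la) (linfZ la).
  by rewrite -(ltr_pM2l t0) in hz; lra.
have h2 : p y - eta - t * q <= p (y + - (t *: z j)).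
  apply: ple; apply: contra_not n2; apply: small_sub => a [[Ba /= ha] /= hz].
  split => //=; have [la _] := Ba; rewrite (linfB la) (linfZ la).
  by rewrite -(ltr_pM2l t0) in hz; lra.
have Gt : G (t *: z j) = d / 2 by rewrite norm_onZp// ltW.
have := dP (t *: z j); rewrite Gt => /(_ ltac:(lra)).
have := dP (- (t *: z j)); rewrite norm_onN Gt => /(_ ltac:(lra)).
rewrite (linfN lf) !ler_norml => /andP[_ k1] /andP[_ k2].
have : t * (e / 2 * G (z j)) = e * d / 4 by rewrite mulrCA tG; field.
have : 0 < e * d by rewrite mulr_gt0.
rewrite /eta in h1 h2 *; lra.
Qed.

(** One representative of each piece of the covers, for all [e] of the form
  [1 / m.+1]; the default 0 stands for the empty pieces. *)
Lemma dual_ball_dense_seq : exists Y : nat -> V -> R,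
  (forall i, dual_ball G (Y i)) /\
  forall a e, dual_ball G a -> 0 < e -> exists i, forall j,
    `|a (z j) - Y i (z j)| <= e * G (z j).
Proof.
have /choice[c cP] : forall m : nat, exists c : (V -> R) -> nat, forall a b,
    dual_ball G a -> dual_ball G b -> c a = c b ->
    forall j, a (z j) - b (z j) <= m.+1%:R^-1 * G (z j).
  by move=> m; apply: dual_ball_small; rewrite invr_gt0.
have /choice[Y YP] : forall mk : nat * nat, exists y, dual_ball G y /\
    forall a, dual_ball G a -> c mk.1 a = mk.2 -> c mk.1 y = mk.2.
  move=> mk; have [[y By cy]|n] :=
      pselect (exists2 y, dual_ball G y & c mk.1 y = mk.2); first by exists y.
  exists (fun=> 0); split; first exact: dual_ball0.
  by move=> a Ba ca; case: n; exists a.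
exists (fun i => Y (odflt (0, 0)%N (unpickle i))); split; first by move=> i; exact: (YP _).1.
move=> a e Ba e0; have [m me] := ltr_add_invr (y := 0) (x := e) e0.
rewrite add0r in me.
exists (pickle (m, c m a)) => j; rewrite pickleK /=.
have [By /(_ a Ba erefl)/= cy] := YP (m, c m a).
have := cP m _ _ Ba By (esym cy) j; have := cP m _ _ By Ba cy j.
have := ler_wpM2r (norm_on_ge0 G (z j)) (ltW me).
move: (m.+1%:R^-1) => r h1 h2 h3; rewrite ler_norml.
lra.
Qed.

End Asplund.

(** * Smooth approximation of the norm along a separable set *)

Section SmoothNorm.
Variables (R : realType) (V : lmodType R) (G : norm_on V) (z : nat -> V).
Local Notation B := (dual_ball G).

(** The dual norm of [a - b] restricted to the range of [z]; a [z i] equal to 0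
  contributes 0 to the supremum because the inverse of 0 is 0. *)
Definition zdist (a b : V -> R) : R :=
  sup [set `|a (z i) - b (z i)| / G (z i) | i in setT].

Lemma zdist_has_ub a b : B a -> B b ->
  has_ubound [set `|a (z i) - b (z i)| / G (z i) | i in setT].
Proof.
move=> Ba Bb; exists 2 => _ [j _ <-]; have [->|Gj] := eqVneq (G (z j)) 0.
  by rewrite invr0 mulr0.
rewrite ler_pdivrMr ?lt_neqAle 1?eq_sym ?Gj ?norm_on_ge0//.
have := dual_ballN (z j) Ba; have := dual_ballN (z j) Bb.
case: Ba => _ /(_ (z j)); case: Bb => _ /(_ (z j)) => *.
by rewrite ler_norml; lra.
Qed.

Lemma zdist_ub a b i : B a -> B b ->
  `|a (z i) - b (z i)| <= zdist a b * G (z i).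
Proof.
move=> Ba Bb; have [G0|G0] := eqVneq (G (z i)) 0.
  by rewrite (norm_on0_eq0 G0) (linf0 Ba.1) (linf0 Bb.1) norm_on0 mulr0 subrr normr0.
have Gp : 0 < G (z i) by rewrite lt_neqAle eq_sym G0 norm_on_ge0.
rewrite -ler_pdivrMr//; apply: ub_le_sup; last by exists i.
exact: zdist_has_ub.
Qed.

Lemma zdist_le a b e : 0 <= e ->
  (forall i, `|a (z i) - b (z i)| <= e * G (z i)) -> zdist a b <= e.
Proof.
move=> e0 h; apply: ge_sup; first by exists (`|a (z 0%N) - b (z 0%N)| / G (z 0%N)), 0%N.
move=> _ [i _ <-]; have [->|G0] := eqVneq (G (z i)) 0; first by rewrite invr0 mulr0.
by rewrite ler_pdivrMr// lt_neqAle eq_sym G0 norm_on_ge0.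
Qed.

Lemma zdist_ge0 a b : B a -> B b -> 0 <= zdist a b.
Proof.
move=> Ba Bb.
apply: le_trans (_ : `|a (z 0%N) - b (z 0%N)| / G (z 0%N) <= _).
  by rewrite divr_ge0// norm_on_ge0.
by apply: ub_le_sup; [exact: zdist_has_ub|exists 0%N].
Qed.

Lemma zdist_le2 a b : B a -> B b -> zdist a b <= 2.
Proof.
move=> Ba Bb; apply: zdist_le => // j.
have := dual_ballN (z j) Ba; have := dual_ballN (z j) Bb.
case: Ba => _ /(_ (z j)); case: Bb => _ /(_ (z j)) => *.
by rewrite ler_norml; lra.
Qed.

Lemma zdist_mid a a' b : B a -> B a' -> B b ->
  zdist (fun v => 2^-1 * (a v + a' v)) b <= 2^-1 * (zdist a b + zdist a' b).
Proof.
move=> Ba Ba' Bb; apply: zdist_le.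
  by have := zdist_ge0 Ba Bb; have := zdist_ge0 Ba' Bb; lra.
move=> i; have := zdist_ub i Ba Bb; have := zdist_ub i Ba' Bb.
by rewrite !ler_norml; lra.
Qed.

(** Lower semicontinuity for the pointwise topology, along ultrafilters. *)
Lemma zdist_lsc (T : Type) (U : set_system T) (a : T -> V -> R) y b e :
  UltraFilter U -> (forall t, B (a t)) -> B y -> B b ->
  (forall v e, 0 < e -> U [set t | `|a t v - y v| < e]) -> 0 < e ->
  U [set t | zdist y b - e < zdist (a t) b].
Proof.
move=> UU Ba By Bb ay e0.
have [lt0|ge0] := ltP (zdist y b - e) 0.
  by apply: filterS filterT => t _ /=; have := zdist_ge0 (Ba t) Bb; lra.
have /existsNP[i /negP] : ~ forall i, `|y (z i) - b (z i)| <= (zdist y b - e / 2) * G (z i).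
  move=> h; have : 0 <= zdist y b - e / 2 by lra.
  by move=> /zdist_le/(_ h); lra.
rewrite -ltNge => hi.
have Gp : 0 < G (z i).
  rewrite lt_neqAle norm_on_ge0 andbT eq_sym; apply/negP => /eqP G0.
  have := zdist_ub i By Bb; move: hi; rewrite G0 !mulr0; lra.
have e1 : 0 < e / 2 * G (z i) by rewrite mulr_gt0//; lra.
apply: filterS (ay (z i) _ e1) => t /= h.
rewrite -(ltr_pM2r Gp); apply: lt_le_trans (zdist_ub i (Ba t) Bb).
have := ler_distD (a t (z i)) (y (z i)) (b (z i)).
rewrite (distrC (y _) (a _ _)); lra.
Qed.

Variable Y : nat -> V -> R.
Hypothesis BY : forall j, B (Y j).

Definition pen_sum J (a : V -> R) : R :=
  \sum_(j < J) 2^-1 ^+ j.+1 * zdist a (Y j) ^+ 2.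

(** The limit of the [pen_sum J], as a supremum.  When [Y] is dense in the
  dual ball for [zdist], the distances to the [Y j] determine a functional on
  the range of [z], up to small errors; the squares make each term strictly
  convex in such a distance. *)
Definition pen (a : V -> R) : R := sup [set pen_sum J a | J in setT].

Lemma pen_sum_le4 J a : B a -> pen_sum J a <= 4 * (1 - 2^-1 ^+ J).
Proof.
move=> Ba; elim: J => [|J IH]; first by rewrite /pen_sum big_ord0 expr0 subrr mulr0.
rewrite /pen_sum big_ord_recr /=; rewrite -/(pen_sum J a).
have q4 : zdist a (Y J) ^+ 2 <= 4.
  by have := zdist_ge0 Ba (BY J); have := zdist_le2 Ba (BY J); nra.
have w0 : 0 < (2^-1 : R) ^+ J by rewrite exprn_gt0.
rewrite exprS; move: (2^-1 ^+ J) w0 IH => w w0 IH; nra.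
Qed.

Lemma pen_sum_homo a J K : (J <= K)%N -> pen_sum J a <= pen_sum K a.
Proof.
move=> /subnK <-; elim: (K - J)%N => [//|m IH].
rewrite addSn /pen_sum big_ord_recr /=; apply: le_trans IH _.
by rewrite lerDl; apply: mulr_ge0; [exact: exprn_ge0|exact: sqr_ge0].
Qed.

Lemma pen_sum_le_pen J a : B a -> pen_sum J a <= pen a.
Proof.
move=> Ba; apply: ub_le_sup; last by exists J.
exists 4 => _ [K _ <-]; apply: le_trans (pen_sum_le4 K Ba) _.
by rewrite ger_pMr// gerBl exprn_ge0.
Qed.

Lemma pen_ge0 a : B a -> 0 <= pen a.
Proof. by move=> Ba; have := pen_sum_le_pen 0%N Ba; rewrite /pen_sum big_ord0. Qed.

Lemma pen_le a M : (forall J, pen_sum J a <= M) -> pen a <= M.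
Proof. by move=> h; apply: ge_sup => [|_ [J _ <-]//]; exists (pen_sum 0%N a), 0%N. Qed.

Lemma pen_le4 a : B a -> pen a <= 4.
Proof.
move=> Ba; apply: pen_le => J; apply: le_trans (pen_sum_le4 J Ba) _.
by rewrite ger_pMr// gerBl exprn_ge0.
Qed.

(** Strict convexity, quantified by any single distance. *)
Lemma pen_mid a b j : B a -> B b ->
  pen (fun v => 2^-1 * (a v + b v)) +
    2^-1 ^+ j.+1 * (zdist a (Y j) - zdist b (Y j)) ^+ 2 / 4 <=
  2^-1 * (pen a + pen b).
Proof.
move=> Ba Bb; rewrite -lerBrDr; apply: pen_le => J.
pose w i : R := 2^-1 ^+ i.+1.
have w0 i : 0 <= w i by rewrite exprn_ge0.
pose D i := (zdist a (Y i) - zdist b (Y i)) ^+ 2.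
(* The term of index [j] has to be among those summed. *)
apply: le_trans (pen_sum_homo _ (leq_maxl J j.+1)) _.
set K := maxn J j.+1; have jK : (j < K)%N by rewrite leq_maxr.
have DK : w j * D j <= \sum_(i < K) w i * D i.
  rewrite (bigD1 (Ordinal jK)) //= lerDl sumr_ge0// => i _.
  by apply: mulr_ge0 => //; exact: sqr_ge0.
have : pen_sum K (fun v => 2^-1 * (a v + b v)) <=
    2^-1 * (pen_sum K a + pen_sum K b) - 4^-1 * \sum_(i < K) w i * D i.
  rewrite /pen_sum -big_split !mulr_sumr -sumrB; apply: ler_sum => i _ /=.
  rewrite -/(w i).
  have := zdist_mid Ba Bb (BY i).
  have := zdist_ge0 (dual_ball_mid Ba Bb) (BY i).
  rewrite /D; move: (zdist _ (Y i)) (zdist a _) (zdist b _) (w i) (w0 i).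
  move=> m p q u u0 m0 mpq.
  have : m ^+ 2 <= (2^-1 * (p + q)) ^+ 2 by rewrite ler_pXn2r ?nnegrE//; lra.
  move=> /(ler_wpM2l u0); lra.
have := pen_sum_le_pen K Ba; have := pen_sum_le_pen K Bb.
rewrite -/(w j) -/(D j); lra.
Qed.

Lemma pen_lsc (T : Type) (U : set_system T) (a : T -> V -> R) y e :
  UltraFilter U -> (forall t, B (a t)) -> B y ->
  (forall v e, 0 < e -> U [set t | `|a t v - y v| < e]) -> 0 < e ->
  U [set t | pen y - e < pen (a t)].
Proof.
move=> UU Ba By ay e0.
have sq j d : 0 < d -> U [set t | zdist y (Y j) ^+ 2 - d < zdist (a t) (Y j) ^+ 2].
  move=> d0; have d4 : 0 < d / 4 by lra.
  apply: filterS (zdist_lsc UU Ba By (BY j) ay d4) => t /=.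
  have := zdist_ge0 (Ba t) (BY j); have := zdist_le2 (Ba t) (BY j).
  have := zdist_ge0 By (BY j); have := zdist_le2 By (BY j).
  move: (zdist y _) (zdist (a t) _) => p q p2 p0 q2 q0 pq.
  have [le_pq|lt_qp] := leP p q; nra.
have part J d : 0 < d -> U [set t | pen_sum J y - d < pen_sum J (a t)].
  elim: J d => [|J IH] d d0.
    by apply: filterS filterT => t _ /=; rewrite /pen_sum !big_ord0; lra.
  have d2 : 0 < d / 2 by lra.
  apply: filterS (filterI (IH _ d2) (sq J _ d2)) => t /= [].
  rewrite /pen_sum !big_ord_recr /= -/(pen_sum J y) -/(pen_sum J (a t)).
  have w0 : 0 < (2^-1 : R) ^+ J.+1 by rewrite exprn_gt0.
  have w1 : (2^-1 : R) ^+ J.+1 <= 1 by rewrite exprn_ile1//; lra.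
  move: (2^-1 ^+ J.+1) (zdist _ _ ^+ 2) (zdist _ _ ^+ 2) w0 w1 => w p q *.
  nra.
have [_ [J _ <-] hJ] : exists2 r, [set pen_sum J y | J in setT] r & pen y - e / 2 < r.
  apply: sup_adherent; first by lra.
  split; first by exists (pen_sum 0%N y), 0%N.
  exists (pen y) => _ [J _ <-]; exact: pen_sum_le_pen.
have e2 : 0 < e / 2 by lra.
apply: filterS (part J _ e2) => t /= h.
have := pen_sum_le_pen J (Ba t); lra.
Qed.

End SmoothNorm.

Section SmoothApprox.
Variables (R : realType) (V : lmodType R) (G : norm_on V) (z : nat -> V).
Local Notation B := (dual_ball G).
Hypothesis norming :
  forall x e, 0 < e -> exists2 f, B f & G x - e < f x.
Variable Y : nat -> V -> R.
Hypothesis BY : forall j, B (Y j).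
Hypothesis densY : forall a e, B a -> 0 < e -> exists i, forall j,
  `|a (z j) - Y i (z j)| <= e * G (z j).
Local Notation pen := (pen G z Y).

(** The norm is the supremum of the dual ball; a small multiple of [pen]
  perturbs it by at most [4 * s] and makes the maximizer strongly unique. *)
Definition smooth_norm (s : R) (x : V) : R := sup [set a x - s * pen a | a in B].

Variable s : R.
Hypothesis s0 : 0 < s.
Local Notation Phi := (smooth_norm s).

Lemma smooth_norm_ub x a : B a -> a x - s * pen a <= Phi x.
Proof.
move=> Ba; apply: ub_le_sup; last by exists a.
exists (G x) => _ [b Bb <-].
have := pen_ge0 z BY Bb; case: Bb => _ /(_ x) h p0.
have : 0 <= s * pen b by apply: mulr_ge0 => //; exact: ltW.
lra.
Qed.

Lemma smooth_norm_le x M : (forall a, B a -> a x - s * pen a <= M) -> Phi x <= M.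
Proof.
move=> h; apply: ge_sup => [|_ [a Ba <-]]; last exact: h.
by exists (0 - s * pen (fun=> 0)), (fun=> 0) => //; exact: dual_ball0.
Qed.

Lemma smooth_norm_adherent x e : 0 < e ->
  exists2 a, B a & Phi x - e < a x - s * pen a.
Proof.
move=> e0; apply: contrapT => h.
suff : Phi x <= Phi x - e by lra.
apply: smooth_norm_le => a Ba; rewrite leNgt; apply/negP => ?.
by apply: h; exists a.
Qed.

Lemma smooth_norm_le_norm x : Phi x <= G x.
Proof.
apply: smooth_norm_le => a Ba; have := pen_ge0 z BY Ba; case: Ba => _ /(_ x) h p0.
have : 0 <= s * pen a by apply: mulr_ge0 => //; exact: ltW.
lra.
Qed.

Lemma smooth_norm_ge x : G x - 4 * s <= Phi x.
Proof.
apply/ler_addgt0Pr => e e0; have [a Ba ax] := norming x e0.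
have := smooth_norm_ub x Ba.
have := ler_wpM2l (ltW s0) (pen_le4 z BY Ba); lra.
Qed.

Lemma smooth_norm_lip x y : Phi x - Phi y <= G (x - y).
Proof.
rewrite lerBlDr; apply: smooth_norm_le => a Ba.
have := smooth_norm_ub y Ba; have [la /(_ (x - y))] := Ba.
rewrite (linfB la); lra.
Qed.

(** A maximizer [y] exists by compactness of the dual ball and lower
  semicontinuity of [pen].  If [b] nearly maximizes, comparing with the
  midpoint of [b] and [y] shows by [pen_mid] that [b] and [y] are almost
  equally far from each [Y j]; as some [Y j] is close to [y], so is [b]. *)
Lemma smooth_norm_strong_max x : exists y, [/\ B y, y x - s * pen y = Phi x &
  forall e, 0 < e -> exists2 eta, 0 < eta & forall b, B b ->
    Phi x - eta < b x - s * pen b ->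
    forall i, `|b (z i) - y (z i)| <= e * G (z i)].
Proof.
have /choice[a aP] : forall n : nat, exists a, B a /\ Phi x - n.+1%:R^-1 < a x - s * pen a.
  move=> n; have [|a Ba h] := @smooth_norm_adherent x n.+1%:R^-1.
    by rewrite invr_gt0.
  by exists a.
have Ba n : B (a n) := (aP n).1.
have [U [UU Uoo]] := @ultraFilterLemma nat \oo _.
have [y By ay] := dual_ball_ultra_lim UU Ba.
have ymax : y x - s * pen y = Phi x.
  apply/eqP; rewrite eq_le smooth_norm_ub//=; apply/ler_addgt0Pr => e e0.
  have e1 : 0 < e / 4 by lra.
  have e2 : 0 < e / 4 / s by rewrite divr_gt0.
  have e3 : U [set n : nat | n.+1%:R^-1 < e / 4].
    apply: Uoo; have [m me] := ltr_add_invr (y := 0) e1; exists m => // n /= mn.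
    apply: le_lt_trans me; rewrite add0r lef_pV2 ?posrE// ler_nat//.
  have [n /= [[h1 h2] h3]] := filter_ex (filterI (filterI (ay x _ e1)
    (pen_lsc z BY UU Ba By ay e2)) e3).
  have := (aP n).2; move: h1; rewrite ltr_norml => /andP[_ h1] h4.
  rewrite -(ltr_pM2l s0) mulrBr (mulrC s (e / 4 / s)) divfK ?gt_eqF// in h2.
  move: h3 h4; move: (n.+1%:R^-1) => r h3 h4; lra.
exists y; split=> // e e0.
have e4 : 0 < e / 4 by lra.
have [j jP] := densY By e4.
pose w : R := 2^-1 ^+ j.+1.
have w0 : 0 < w by rewrite exprn_gt0.
have yj : zdist G z y (Y j) <= e / 4 by apply: zdist_le => //; exact: ltW.
exists (s * w * (e / 4) ^+ 2 / 8); first by rewrite !mulr_gt0.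
move=> b Bb hb i.
have := smooth_norm_ub x (dual_ball_mid Bb By).
have /= := pen_mid z BY j Bb By; rewrite -/w => h1 h2.
have h3 : s * (w * (zdist G z b (Y j) - zdist G z y (Y j)) ^+ 2 / 4) <=
    s * w * (e / 4) ^+ 2 / 4.
  have : 0 < s * w * (e / 4) ^+ 2 by rewrite !mulr_gt0.
  move/(ler_wpM2l (ltW s0)): h1; lra.
have h4 : (zdist G z b (Y j) - zdist G z y (Y j)) ^+ 2 <= (e / 4) ^+ 2.
  rewrite -(ler_pM2l (mulr_gt0 s0 w0)); lra.
have h5 : zdist G z b (Y j) <= e / 2.
  by rewrite leNgt; apply/negP => h5; nra.
have := zdist_ub z i Bb (BY j); have := zdist_ub z i By (BY j).
have := ler_wpM2r (norm_on_ge0 G (z i)) yj.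
have := ler_wpM2r (norm_on_ge0 G (z i)) h5.
by rewrite !ler_norml; lra.
Qed.

Definition adherent (h : V) := forall e, 0 < e -> exists i, G (h - z i) < e.

Lemma adherent_le a b e h : B a -> B b -> 0 <= e ->
  (forall i, `|a (z i) - b (z i)| <= e * G (z i)) -> adherent h ->
  a h - b h <= e * G h.
Proof.
move=> Ba Bb e0 ab ah; apply/ler_addgt0Pr => d d0.
have d1 : 0 < d / (e + 2) by rewrite divr_gt0//; lra.
have [i hi] := ah _ d1.
have [la /(_ (h - z i))] := Ba; have [lb _] := Bb.
have := dual_ballN (h - z i) Bb.
have := ab i; rewrite (linfB la) (linfB lb) ler_norml => /andP[_].
have := ler_wpM2l e0 (norm_onB G (z i) h); rewrite (norm_onBC G (z i)).
have : (e + 2) * G (h - z i) <= d.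
  by rewrite mulrC -ler_pdivlMr ?ltW//; lra.
lra.
Qed.

(** Functionals nearly maximizing at [x + h] nearly maximize at [x], hence
  agree with [y] on [h] up to a small multiple of the norm of [h].  The upper
  estimate is the one that turns minimality over a set into normality. *)
Lemma smooth_norm_frechet x : exists y, [/\ B y, y x - s * pen y = Phi x &
  forall e, 0 < e -> exists2 d, 0 < d & forall h, adherent h -> G h < d ->
    Phi (x + h) <= Phi x + y h + e * G h].
Proof.
have [y [By yx yP]] := smooth_norm_strong_max x; exists y; split=> // e e0.
have [eta eta0 etaP] := yP _ e0.
exists (eta / 4) => [|h ah hd]; first by lra.
apply/ler_addgt0Pr => t t0.
have m0 : 0 < Num.min t (eta / 4) by rewrite lt_min t0/=; lra.
have [a Ba ha] := smooth_norm_adherent (x + h) m0.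
have [mt me] : Num.min t (eta / 4) <= t /\ Num.min t (eta / 4) <= eta / 4.
  by split; rewrite ge_min lexx ?orbT.
have [la aG] := Ba; rewrite (linfD la) in ha.
have ahle : a h - y h <= e * G h.
  apply: adherent_le => //; first exact: ltW.
  apply: etaP => //.
  have := smooth_norm_lip x (x + h); rewrite opprD addNKr norm_onN.
  have := aG h; lra.
have := smooth_norm_ub x Ba; lra.
Qed.

End SmoothApprox.

(** * A variational principle of Borwein-Preiss type *)

Lemma half_expn_small (R : realType) (C e : R) : 0 < e ->
  exists k0, forall k, (k0 <= k)%N -> C * 2^-1 ^+ k < e.
Proof.
move=> e0; have C0 : 0 < `|C| + 1 by rewrite ltr_wpDl.
have [k0 hk0] := ltr_add_invr (y := 0) (divr_gt0 e0 C0).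
rewrite add0r in hk0; exists k0 => k kk.
have w0 : 0 < (2^-1 : R) ^+ k by rewrite exprn_gt0.
apply: le_lt_trans (_ : (`|C| + 1) * 2^-1 ^+ k < _).
  by rewrite ler_pM2r//; have := ler_norm C; lra.
rewrite mulrC -ltr_pdivlMr//; apply: le_lt_trans hk0.
rewrite exprVn lef_pV2 ?posrE ?exprn_gt0// -natrX ler_nat.
exact: leq_ltn_trans kk (ltn_expl _ _).
Qed.

Section Variational.
Variables (R : realType) (V : lmodType R) (G : norm_on V).
Local Notation hf k := ((2^-1 : R) ^+ k).

(** Completeness tested on sequences of geometrically decreasing steps: unlike
  a statement about filters, it passes at once to an equivalent norm. *)
Definition geom_complete := forall (u : nat -> V) C,
  (forall k, G (u k.+1 - u k) <= C * hf k) ->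
  exists l C', forall k, G (u k - l) <= C' * hf k.

Definition norm_closed (F : set V) := forall x,
  (forall e, 0 < e -> exists2 y, F y & G (y - x) < e) -> F x.

Hypothesis complG : geom_complete.

(** [c m.+1] nearly minimizes over [F] the function perturbed by the
  terms centred at [c 0], ..., [c m].  The term centred at [c m] keeps [c m.+1]
  close to [c m], because [psi m] is the norm up to an error that decreases
  with [m]; hence the [c m] converge, to a minimizer [x] of the limit
  function.  The conclusion compares only partial sums: the terms of index
  at least [m] are Lipschitz with total constant [2 * mu * hf m]. *)
Lemma borwein_preiss (F : set V) (f : V -> R) (psi : nat -> V -> R) (M mu : R) :
  norm_closed F -> F !=set0 -> 0 < mu ->
  (forall x, - M <= f x) -> (forall x y, f x - f y <= G (x - y)) ->
  (forall k h, G h <= psi k h <= G h + 4 * hf k) ->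
  (forall k x y, psi k x - psi k y <= G (x - y)) ->
  exists (c : nat -> V) x, F x /\ forall m w, F w ->
    f x + \sum_(j < m) mu * hf j * psi j (x - c j) <=
    f w + \sum_(j < m) mu * hf j * psi j (w - c j) + 2 * mu * hf m * G (w - x).
Proof.
move=> clF [w0 Fw0] mu0 fM flip psib psilip.
have h0 k : 0 < hf k by rewrite exprn_gt0.
have hS k : hf k.+1 = hf k / 2 by rewrite exprSr.
have /choice[pick pickP] : forall kg : nat * (V -> R), exists y,
    (forall x, - M <= kg.2 x) -> F y /\
    forall w, F w -> kg.2 y <= kg.2 w + mu * hf kg.1 * hf kg.1.
  move=> [k g] /=; have [gM|ngM] := pselect (forall x, - M <= g x); last by exists 0 => /ngM.
  have e0 : 0 < mu * hf k * hf k by rewrite !mulr_gt0.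
  have hi : has_inf (g @` F).
    by split; [exists (g w0), w0 | exists (- M) => _ [y _ <-]].
  have [_ [y Fy <-] yP] := inf_adherent e0 hi.
  exists y => _; split=> // w Fw; apply: le_trans (ltW yP) _.
  by rewrite lerD2r; apply: ge_inf; [exact: hi.2|exists w].
pose vf := fix vf k : V -> R := if k is k'.+1 then
  fun x => vf k' x + mu * hf k' * psi k' (x - pick (k', vf k')) else f.
pose c k := pick (k, vf k).
have vfS k x : vf k.+1 x = vf k x + mu * hf k * psi k (x - c k) by [].
have vfE k x : vf k x = f x + \sum_(j < k) mu * hf j * psi j (x - c j).
  elim: k => [|k IH]; first by rewrite big_ord0 addr0.
  by rewrite vfS IH big_ord_recr /= addrA.
have psi0 k h : 0 <= psi k h.
  by have /andP[+ _] := psib k h; apply: le_trans; exact: norm_on_ge0.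
have m0 k : 0 < mu * hf k by rewrite mulr_gt0.
have vfM k x : - M <= vf k x.
  elim: k => [//|k IH]; rewrite vfS.
  by have := mulr_ge0 (ltW (m0 k)) (psi0 k (x - c k)); lra.
have Fc k : F (c k) := (pickP (k, vf k) (vfM k)).1.
have cmin k w : F w -> vf k (c k) <= vf k w + mu * hf k * hf k.
  exact: (pickP (k, vf k) (vfM k)).2.
have tail m k w x : vf (k + m)%N w - vf (k + m)%N x <=
    vf m w - vf m x + 2 * mu * (hf m - hf (k + m)%N) * G (w - x).
  elim: k => [|k IH]; first by rewrite add0n subrr mulr0 mul0r addr0.
  rewrite addSn !vfS hS.
  have := psilip (k + m)%N (w - c (k + m)%N) (x - c (k + m)%N).
  rewrite opprB subrKA.
  move=> /(ler_wpM2l (ltW (m0 (k + m)%N))); lra.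
have lip k w x : vf k w - vf k x <= (1 + 2 * mu) * G (w - x).
  have := tail 0%N k w x; rewrite addn0 /= expr0.
  have := flip w x; have := mulr_ge0 (mulr_ge0 (ltW mu0) (ltW (h0 k))) (norm_on_ge0 G (w - x)).
  lra.
(* 6 collects the errors of the two near minimizations and [4 * hf k], the
   deviation of [psi k] from the norm. *)
have step k : G (c k.+1 - c k) <= 6 * hf k.
  rewrite -(ler_pM2l (m0 k)).
  have /andP[p1 _] := psib k (c k.+1 - c k).
  have /andP[_ p2] := psib k (c k - c k); rewrite subrr norm_on0 in p2.
  have := cmin k.+1 _ (Fc k); have := cmin k _ (Fc k.+1).
  rewrite !vfS subrr hS.
  move/(ler_wpM2l (ltW (m0 k))): p1; move/(ler_wpM2l (ltW (m0 k))): p2.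
  have := mulr_gt0 (m0 k) (h0 k).
  lra.
have [x [C xP]] := complG step.
have Fx : F x.
  apply: clF => e e0; have [k0 /(_ k0 (leqnn _)) hk] := half_expn_small C e0.
  by exists (c k0) => //; exact: le_lt_trans (xP k0) hk.
exists c, x; split=> // m w Fw; rewrite -!vfE.
apply/ler_addgt0Pr => e e0.
have [k0 /(_ (k0 + m)%N (leq_addr _ _)) hk] := half_expn_small (mu + (1 + 2 * mu) * C) e0.
have := tail m k0 w x; have := cmin (k0 + m)%N _ Fw.
have := lip (k0 + m)%N x (c (k0 + m)%N).
have := xP (k0 + m)%N; rewrite (norm_onBC _ (c _)).
have k1 : hf (k0 + m)%N <= 1 by rewrite exprn_ile1//; lra.
have := h0 (k0 + m)%N; have := norm_on_ge0 G (w - x).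
have L0 : 0 <= 1 + 2 * mu by lra.
move=> g0 p0 /(ler_wpM2l L0) q1 q2 q3 q4.
have := mulr_ge0 (mulr_ge0 (ltW mu0) (ltW p0)) g0.
have := ler_wpM2l (ltW (mulr_gt0 mu0 p0)) k1.
lra.
Qed.

End Variational.

(** * Frechet normals in the separable case *)

Section SeparableNormal.
Variables (R : realType) (V : lmodType R) (G : norm_on V).
Local Notation B := (dual_ball G).
Local Notation hf k := ((2^-1 : R) ^+ k).
Hypothesis AG : frechet_dense G.
Hypothesis complG : geom_complete G.

Definition normal_to (F : set V) (x : V) (a : V -> R) :=
  forall e, 0 < e -> exists2 d, 0 < d &
    forall w, F w -> G (w - x) < d -> a (w - x) <= e * G (w - x).

Lemma norm_closed_dist (F : set V) (b : V) : norm_closed G F -> ~ F b ->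
  exists2 r, 0 < r & forall w, F w -> r <= G (w - b).
Proof.
move=> clF nFb; apply: contrapT => h; apply: nFb; apply: clF => e e0.
apply: contrapT => h'; apply: h; exists e => // w Fw.
by rewrite leNgt; apply/negP => ?; apply: h'; exists w.
Qed.

(** Apply [borwein_preiss] to the smoothed distance to [b], with smoothed norms
  as perturbations.  The function minimized at [x] is differentiable at [x] in
  the directions leading to points of [F], up to a Lipschitz tail; the opposite
  of its derivative is a normal to [F]. It nearly norms [b - x]
  because the distance to [b] is the dominant term. *)
Lemma separable_normal (z : nat -> V) (F : set V) (b x0 : V) :
  norm_closed G F -> F x0 -> ~ F b ->
  (forall w x, F w -> F x -> adherent G z (w - x)) ->
  exists x a, [/\ F x, B a, G (x - b) <= 2 * G (x0 - b),
    15 / 16 * G (b - x) <= a (b - x) & normal_to F x a].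
Proof.
move=> clF Fx0 nFb adF.
have [r r0 rF] := norm_closed_dist clF nFb.
have norming := dual_ball_norming AG.
have [Y [BY densY]] := dual_ball_dense_seq AG z.
(* [s] is small against the distance [r] from [b] to [F], and [mu] against 1,
   so that all errors together stay below 1/16 of [G (b - x)]. *)
pose s := r / 256; have s0 : 0 < s by rewrite divr_gt0.
have h0 k : 0 < hf k by rewrite exprn_gt0.
pose mu : R := 128^-1.
pose f x := smooth_norm G z Y s (x - b).
pose psi k x := smooth_norm G z Y (hf k) x + 4 * hf k.
have [||||||c [x [Fx xmin]]] := @borwein_preiss _ _ _ complG F f psi (4 * s) mu clF.
- by exists x0.
- by rewrite invr_gt0.
- move=> x; have := smooth_norm_ge z norming BY s0 (x - b).
  by have := norm_on_ge0 G (x - b); rewrite /f; lra.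
- move=> x y; apply: le_trans (smooth_norm_lip _ BY s0 _ _) _.
  by rewrite opprB addrA subrK.
- move=> k h; have := smooth_norm_ge z norming BY (h0 k) h.
  by have := smooth_norm_le_norm z BY (h0 k) h; rewrite /psi; lra.
- move=> k x y; have := smooth_norm_lip z BY (h0 k) x y.
  by rewrite /psi; lra.
have [y0 [By0 y0E y0P]] := smooth_norm_frechet BY densY s0 (x - b).
have /choice[v vP] : forall j, exists v, B v /\
    forall e, 0 < e -> exists2 d, 0 < d & forall h, adherent G z h -> G h < d ->
    psi j (x + h - c j) <= psi j (x - c j) + v h + e * G h.
  move=> j; have [v [Bv _ vP]] := smooth_norm_frechet BY densY (h0 j) (x - c j).
  exists v; split=> // e e0; have [d d0 dP] := vP _ e0; exists d => // h ah hd.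
  by have := dP _ ah hd; rewrite /psi (addrAC x h); lra.
pose sub m h := y0 h + \sum_(j < m) mu * hf j * v j h.
have subS m h : sub m.+1 h = sub m h + mu * hf m * v m h.
  by rewrite /sub big_ord_recr /= addrA.
have mu0 k : 0 < mu * hf k by rewrite mulr_gt0// invr_gt0.
have subl m : scalar (sub m).
  move=> t g h; elim: m => [|m IH].
    by rewrite /sub !big_ord0 !addr0; have [ly0 _] := By0; exact: ly0.
  rewrite !subS IH; have [[lv _] _] := vP m; rewrite lv; ring.
have hS k : hf k.+1 = hf k / 2 by rewrite exprSr.
have subk m k h : `|sub (k + m)%N h - sub m h| <= 2 * mu * (hf m - hf (k + m)%N) * G h.
  elim: k => [|k IH]; first by rewrite add0n !subrr normr0 mulr0 mul0r.
  rewrite addSn subS hS; have [Bv _] := vP (k + m)%N.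
  have vl : v (k + m)%N h <= G h by case: Bv.
  have vg := dual_ballN h Bv; move: IH; rewrite !ler_norml.
  have := ler_wpM2l (ltW (mu0 (k + m)%N)) vl.
  have := ler_wpM2l (ltW (mu0 (k + m)%N)) vg.
  lra.

have subG m h : sub m h <= (1 + 2 * mu) * G h.
  have := subk 0%N m h; rewrite addn0 expr0 {2}/sub big_ord0 addr0 ler_norml.
  move=> /andP[_]; have [_ /(_ h)] := By0.
  have := mulr_ge0 (ltW (mu0 m)) (norm_on_ge0 G h); lra.
(* The derivatives [sub m] of the partial sums have norm at most
   [1 + 2 * mu]; a cluster point of their normalized opposites is the normal. *)
pose a_ m h := - (sub m h / (1 + 2 * mu)).
have K0 : 0 < 1 + 2 * mu by rewrite /mu; lra.
have Ba_ m : B (a_ m).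
  split=> [t g h|h]; first by rewrite /a_ (subl m); ring.
  rewrite /a_ -mulNr -(linfN (subl m)) ler_pdivrMr// mulrC.
  by rewrite -(norm_onN G); exact: subG.
have [U [UU Uoo]] := @ultraFilterLemma nat \oo _.
have [a Ba ay] := dual_ball_ultra_lim UU Ba_.
have a_near m h : `|a h - a_ m h| <= 2 * mu * hf m * G h.
  apply/ler_addgt0Pr => e e0.
  have mU : U [set k | (m <= k)%N] by apply: Uoo; exists m.
  have [k /= [hk mk]] := filter_ex (filterI (ay h e e0) mU).
  have := subk m (k - m)%N h; rewrite subnK// => hs.
  have : `|a_ k h - a_ m h| <= 2 * mu * hf m * G h.
    rewrite /a_ -opprD -mulrBl normrN normrM.
    rewrite [`|_^-1|]gtr0_norm ?invr_gt0// ler_pdivrMr//.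
    apply: le_trans hs _; rewrite /mu.
    have := mulr_ge0 (ltW (h0 m)) (norm_on_ge0 G h).
    have := mulr_ge0 (ltW (h0 k)) (norm_on_ge0 G h); lra.
  have := ler_distD (a_ k h) (a h) (a_ m h); rewrite (distrC (a h) (a_ k h)); lra.
exists x, a; split=> //.
- have := xmin 0%N _ Fx0; rewrite !big_ord0 !addr0 expr0 /f.
  have := smooth_norm_ge z norming BY s0 (x - b).
  have := smooth_norm_le_norm z BY s0 (x0 - b).
  have := rF _ Fx0; have := norm_on_tri G b x0 x; rewrite (norm_onBC G b).
  have := norm_on_ge0 G (x - b).
  rewrite /s /mu; lra.
- have rG := rF _ Fx.
  have y0b : G (x - b) - 4 * s <= y0 (x - b).
    have := smooth_norm_ge z norming BY s0 (x - b).
    have := mulr_ge0 (ltW s0) (pen_ge0 z BY By0); lra.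
  have := a_near 0%N (b - x); rewrite expr0 ler_norml => /andP[+ _].
  have : 62 / 64 * G (x - b) <= a_ 0%N (b - x).
    rewrite /a_ /sub big_ord0 addr0 -mulNr -(linfN By0.1) opprB ler_pdivlMr//.
    by move: y0b; rewrite /s /mu; lra.
  have := norm_on_ge0 G (x - b).
  by rewrite (norm_onBC G b) /mu; lra.
- move=> e e0.
  have [m /(_ m (leqnn _)) hm] := half_expn_small 4 e0.
  have [d d0 dP] : exists2 d, 0 < d & forall h, adherent G z h -> G h < d ->
      f (x + h) + \sum_(j < m) mu * hf j * psi j (x + h - c j) <=
      f x + \sum_(j < m) mu * hf j * psi j (x - c j) + sub m h + e / 4 * G h.
    have : 0 < e / 4 by lra.
    move: (e / 4) => {hm e0}e e0; elim: m e e0 => [|m IH] e e0.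
      have [d d0 dP] := y0P _ e0; exists d => // h ah hd.
      rewrite /sub !big_ord0 !addr0 /f (addrAC x h); exact: dP.
    have e2 : 0 < e / 2 by lra.
    have [d d0 dP] := IH _ e2; have [_ /(_ _ e2)[d' d'0 d'P]] := vP m.
    exists (Num.min d d') => [|h ah]; first by rewrite lt_min d0.
    rewrite lt_min => /andP[hd hd']; rewrite subS !big_ord_recr /=.
    have := dP _ ah hd; have := d'P _ ah hd' => /(ler_wpM2l (ltW (mu0 m))).
    have m1 : mu * hf m <= 1.
      rewrite mulr_ile1 ?invr_ge0 ?exprn_ge0 ?exprn_ile1 ?invf_le1//; lra.
    have := ler_wpM2r (mulr_ge0 (ltW e2) (norm_on_ge0 G h)) m1.
    move: (mu * hf m) => p; lra.
  exists d => // w Fw wd.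
  have := dP _ (adF _ _ Fw Fx) wd; rewrite (addrC x) subrK => h1.
  have h2 := xmin m _ Fw.
  have := a_near m (w - x); rewrite ler_norml => /andP[_].
  have h3 : a_ m (w - x) <= (e / 4 + 2 * mu * hf m) * G (w - x).
    rewrite /a_ lerNl ler_pdivlMr//.
    have g0 := norm_on_ge0 G (w - x).
    have := mulr_ge0 (mulr_ge0 (ltW (mu0 m)) g0) (ltW K0).
    have := mulr_ge0 (ltW (mu0 m)) g0.
    have := mulr_ge0 (ltW e0) g0.
    move: h1 h2; rewrite /mu; lra.
  have := ler_wpM2r (norm_on_ge0 G (w - x)) (ltW hm).
  have := mulr_ge0 (ltW (h0 m)) (norm_on_ge0 G (w - x)).
  move: h3; rewrite /mu; lra.
Qed.

End SeparableNormal.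

(** * Separable reduction *)

Section SeparableReduction.
Variables (R : realType) (V : lmodType R) (G : norm_on V).
Local Notation B := (dual_ball G).
Hypothesis AG : frechet_dense G.
Hypothesis complG : geom_complete G.
Variables (Om : set V) (b : V).

(** A finite test of whether [a] nearly norms [b - d] and is normal to [Om] at
  [d].  The natural numbers in [p] encode the slack [1 / p.1.+1] and, for each
  tolerance [1 / k.+1], the radius within which it is required; thus the
  parameters are countably many.  The slack makes the outcome stable when [d]
  moves a little, so that tests at countably many [d] suffice. *)
Definition almost_normal (d : V) (p : nat * seq nat) (L : seq V) (a : V -> R) :=
  [/\ B a, 15 / 16 * G (b - d) - p.1.+1%:R^-1 <= a (b - d) &
   forall w k, w \in L -> Om w -> (k < size p.2)%N ->
     G (w - d) < (nth 0%N p.2 k).+1%:R^-1 + p.1.+1%:R^-1 ->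
     a (w - d) <= k.+1%:R^-1 * G (w - d) + p.1.+1%:R^-1].

(** Compactness: functionals that pass larger and larger finite tests have a
  cluster point, which passes them all, and would be a normal. *)
Lemma finite_failure (x : V) (D : nat -> nat) :
  (forall a, B a -> 15 / 16 * G (b - x) <= a (b - x) -> ~ normal_to G Om x a) ->
  exists m (L : seq V), forall a, B a -> 15 / 16 * G (b - x) - m.+1%:R^-1 <= a (b - x) ->
    ~ forall w k, w \in L -> Om w -> (k <= m)%N -> G (w - x) < (D k).+1%:R^-1 ->
      a (w - x) <= k.+1%:R^-1 * G (w - x) + m.+1%:R^-1.
Proof.
move=> nox; apply: contrapT => nfin.
have /choice[A AP] : forall t : nat * seq V, exists a,
    [/\ B a, 15 / 16 * G (b - x) - t.1.+1%:R^-1 <= a (b - x) &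
    forall w k, w \in t.2 -> Om w -> (k <= t.1)%N -> G (w - x) < (D k).+1%:R^-1 ->
      a (w - x) <= k.+1%:R^-1 * G (w - x) + t.1.+1%:R^-1].
  move=> [m L]; apply: contrapT => h; apply: nfin; exists m, L => a Ba ba wa.
  by apply: h; exists a.
pose S (t : nat * seq V) := [set u : nat * seq V | (t.1 <= u.1)%N /\ {subset t.2 <= u.2}].
have FF : ProperFilter (filter_from setT S).
  apply: filter_from_proper => [|t _]; last by exists t; split.
  apply: filter_from_filter; first by exists (0%N, [::]).
  move=> [m L] [m' L'] _ _; exists (maxn m m', L ++ L') => // u [/= mu Lu].
  move: mu; rewrite geq_max => /andP[m1 m2]; split; split=> //= w wL;
    by apply: Lu; rewrite mem_cat wL ?orbT.
have [U [UU US]] := ultraFilterLemma FF.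
have BA t : B (A t) by case: (AP t).
have [y By yA] := dual_ball_ultra_lim UU BA.
have Um m L : U (S (m, L)) by apply: US; exists (m, L).
have small (e : R) : 0 < e -> exists m, forall n, (m <= n)%N -> n.+1%:R^-1 < e.
  move=> e0; have [m hm] := ltr_add_invr (y := 0) e0; exists m => n mn.
  by apply: le_lt_trans hm; rewrite add0r lef_pV2 ?posrE// ler_nat.
apply: (nox y By).
  apply/ler_addgt0Pr => e e0; have e2 : 0 < e / 2 by lra.
  have [m mP] := small _ e2.
  have [t /= [h1 [/mP h2 _]]] := filter_ex (filterI (yA (b - x) _ e2) (Um m [::])).
  have [_ h3 _] := AP t; move: h1; rewrite ltr_norml => /andP[_].
  move: h2 h3; move: (t.1.+1%:R^-1) => q; lra.
move=> e e0; have [k kP] := small _ e0.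
exists (D k).+1%:R^-1; first by rewrite invr_gt0.
move=> w Ow wx; apply/ler_addgt0Pr => d d0; have d2 : 0 < d / 2 by lra.
have [m mP] := small _ d2.
have [t /= [h1 [/= ht hw]]] :=
  filter_ex (filterI (yA (w - x) _ d2) (Um (maxn k m) [:: w])).
move: ht; rewrite geq_max => /andP[kt /mP h2].
have [_ _ /(_ w k (hw _ (mem_head _ _)) Ow kt wx)] := AP t.
have := ler_wpM2r (norm_on_ge0 G (w - x)) (ltW (kP k (leqnn k))).
move: h1; rewrite ltr_norml => /andP[h1 _].
move: h2; move: (t.1.+1%:R^-1) (k.+1%:R^-1) => q q'; lra.
Qed.

(** For each point and parameter choose a finite list on which every functional
  fails the test, if there is one.  The points reached from [x0] through these
  lists are countably many, and [separable_normal] yields a normal [a] to the part [F]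
  of [Om] in their closure, at some [x].  If no functional were normal to
  [Om] at [x], then by [finite_failure] some finite test would fail for all of
  them at [x], hence, by the slack, at a reached point [d] near [x], and so
  would the test chosen for [d].  But the points of [Om] used by the latter
  are in [F], so that [a] passes it. *)
Theorem norming_normal (x0 : V) : norm_closed G Om -> Om x0 -> ~ Om b ->
  exists x a, [/\ Om x, B a, G (x - b) <= 2 * G (x0 - b),
    15 / 16 * G (b - x) <= a (b - x) & normal_to G Om x a].
Proof.
move=> clO Ox0 nOb; apply: contrapT => nox.
have /choice[W WP] : forall dp : V * (nat * seq nat), exists L,
    (exists L' : seq V, forall a, ~ almost_normal dp.1 dp.2 L' a) ->
    forall a, ~ almost_normal dp.1 dp.2 L a.
  move=> dp; have [[L LP]|n] :=
    pselect (exists L' : seq V, forall a, ~ almost_normal dp.1 dp.2 L' a).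
    by exists L.
  by exists [::] => /n.
pose step d (pi : (nat * seq nat) * nat) := nth 0 (W (d, pi.1)) pi.2.
pose reach : seq ((nat * seq nat) * nat) -> V := foldl step x0.
pose F := [set x | Om x /\ forall e, 0 < e -> exists u, G (x - reach u) < e].
pose z n := if unpickle n is Some uv then reach uv.1 - reach uv.2 else 0.
have Freach u : Om (reach u) -> F (reach u).
  by move=> Ou; split=> // e e0; exists u; rewrite subrr norm_on0.
have clF : norm_closed G F.
  move=> x xF; split.
    by apply: clO => e /xF[y [Oy _] yx]; exists y.
  move=> e e0; have e2 : 0 < e / 2 by lra.
  have [y [_ /(_ _ e2)[u yu]] yx] := xF _ e2; exists u.
  have := norm_on_tri G y x (reach u); rewrite (norm_onBC G x y); lra.
have adF w x : F w -> F x -> adherent G z (w - x).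
  move=> [_ wF] [_ xF] e e0; have e2 : 0 < e / 2 by lra.
  have [u wu] := wF _ e2; have [v xv] := xF _ e2.
  exists (pickle (u, v)); rewrite /z pickleK /=.
  have -> : w - x - (reach u - reach v) = (w - reach u) - (x - reach v).
    by rewrite !opprB addrACA [in RHS]addrACA (addrC (- x)).
  apply: le_lt_trans (norm_onD _ _ _) _; rewrite norm_onN; lra.
have [x [a [Fx Ba xb ab aF]]] :=
  separable_normal AG complG clF (Freach [::] Ox0) (fun Fb => nOb Fb.1) adF.
have /choice[D DP] : forall k : nat, exists d : nat, forall w, F w ->
    G (w - x) < 2 * d.+1%:R^-1 -> a (w - x) <= k.+1%:R^-1 * G (w - x).
  move=> k; have [|d d0 dP] := aF k.+1%:R^-1; first by rewrite invr_gt0.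
  have d2 : 0 < d / 2 by lra.
  have [n hn] := ltr_add_invr (y := 0) d2; exists n => w Fw wx.
  by apply: dP => //; move: hn wx; move: (n.+1%:R^-1) => q; lra.
have [|m [L LP]] := @finite_failure x D.
  by move=> a' Ba' ba' na'; apply: nox; exists x, a'; split=> //; case: Fx.
(* The slack at [d] is below that of the failing test at [x], and below
   all the radii in it. *)
pose M := (4 * m.+1 + 2 * \sum_(k < m.+1) (D k).+1)%N.
pose r : R := M.+1%:R^-1.
have r0 : 0 < r by rewrite invr_gt0.
have rm : 4 * r <= m.+1%:R^-1.
  rewrite -ler_pdivlMl// mulrC -[_ / 4]invfM lef_pV2 ?posrE ?mulr_gt0//.
  by rewrite -natrM ler_nat /M mulnC -addnS leq_addr.
have rD k : (k <= m)%N -> 2 * r <= (D k).+1%:R^-1.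
  move=> km; rewrite -ler_pdivlMl// mulrC -[_ / 2]invfM lef_pV2 ?posrE ?mulr_gt0//.
  rewrite -natrM ler_nat /M mulnC; apply: leqW; apply: leq_trans (leq_addl _ _).
  by rewrite leq_pmul2l// (bigD1 (Ordinal (km : (k < m.+1)%N)))//= leq_addr.
have [_ xF] := Fx.
have [u xu] : exists u, G (x - reach u) < r / 4 by apply: xF; rewrite divr_gt0.
pose d := reach u; pose p := (M, mkseq D m.+1).
have pk k : (k < size p.2)%N -> (k <= m)%N /\ nth 0%N p.2 k = D k.
  by rewrite size_mkseq ltnS => km; rewrite nth_mkseq.
have V1 k : (k.+1%:R^-1 : R) <= 1 by rewrite invf_le1// ler1n.
have V0 k : 0 <= (k.+1%:R^-1 : R) by rewrite invr_ge0.
have tri w : G (w - d) <= G (w - x) + r / 4 /\ G (w - x) <= G (w - d) + r / 4.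
  have := norm_on_tri G x w d; have := norm_on_tri G d w x.
  by rewrite (norm_onBC G d x) -/d in xu *; split; lra.
have triZ w k : k.+1%:R^-1 * G (w - d) <= k.+1%:R^-1 * G (w - x) + r / 4 /\
    k.+1%:R^-1 * G (w - x) <= k.+1%:R^-1 * G (w - d) + r / 4.
  have [/(ler_wpM2l (V0 k)) h1 /(ler_wpM2l (V0 k)) h2] := tri w.
  have r4 : 0 <= r / 4 by rewrite divr_ge0 ?ltW.
  have := ler_wpM2r r4 (V1 k).
  by move: (k.+1%:R^-1) h1 h2 => q h1 h2 h3; split; lra.
have triB c w : B c -> `|c (w - x) - c (w - d)| < r / 4.
  move=> Bc; have [lc /(_ (x - d)) cd] := Bc; have := dual_ballN (x - d) Bc.
  rewrite !(linfB lc) in cd *; rewrite ltr_norml => h.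
  by move: xu; rewrite -/d; lra.
have WPd := WP (d, p); apply: (WPd _ a); first exists L => c [/= Bc cb cL].
  apply: (LP c Bc).
    have := triB c b Bc; rewrite ltr_norml => /andP[+ _].
    have [_] := tri b; move: cb rm; rewrite -/r; move: (m.+1%:R^-1) => q; lra.
  move=> w k wL Ow km wx; have := triB c w Bc; rewrite ltr_norml => /andP[_].
  have [h1 _] := tri w; have [h2 _] := triZ w k.
  have kp : (k < size p.2)%N by rewrite size_mkseq ltnS.
  have := cL w k wL Ow kp; rewrite (pk k kp).2 -/r.
  move: wx h1 h2 rm; move: (k.+1%:R^-1 * G (w - x)) (k.+1%:R^-1 * _) => s s'.
  move: ((D k).+1%:R^-1) (m.+1%:R^-1) => q q' wx h1 h2 rm /(_ ltac:(lra)); lra.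
split=> //=.
  have := triB a b Ba; rewrite ltr_norml => /andP[_].
  have [+ _] := tri b; move: ab; rewrite -/r; lra.
move=> w k wL Ow kp; have [km ->] := pk k kp; rewrite -/r => wd.
have Fw : F w.
  move: wL Ow => /(nthP 0)[i iL <-] Ow; move: Ow.
  have -> : nth 0 (W (d, p)) i = reach (rcons u (p, i)) by rewrite /reach foldl_rcons.
  exact: Freach.
have [_ h1] := tri w; have [_ h2] := triZ w k.
have := rD k km; have := DP k w Fw; have := triB a w Ba; rewrite ltr_norml => /andP[h3 _].
move: wd h2; move: (k.+1%:R^-1) => s.
move: ((D k).+1%:R^-1) => q wd h2 /[swap] rq /(_ ltac:(lra)); lra.
Qed.
End SeparableReduction.

(** * Translation of the topological notions *)

Section NormedModule.
Variables (R : realType) (E : normedModType R).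

Definition normr_on : norm_on E :=
  NormOn (@ler_normD _ E) (@normrZ _ E) (@normr0_eq0 _ E).

Lemma banach_geom_complete : banach E -> geom_complete normr_on.
Proof.
move=> bE u C uC.
have h0 k : 0 < (2^-1 : R) ^+ k by rewrite exprn_gt0.
have C0 : 0 <= C.
  by have := uC 0%N; rewrite expr0 mulr1; apply: le_trans; exact: norm_on_ge0.
have far j k : `|u (j + k)%N - u k| <= 2 * C * (2^-1 ^+ k - 2^-1 ^+ (j + k)).
  elim: j => [|j IH]; first by rewrite add0n !subrr normr0 mulr0.
  rewrite addSn; apply: le_trans (ler_distD (u (j + k)%N) _ _) _.
  by have := uC (j + k)%N; rewrite /= exprSr; lra.
have cu : cauchy (u @ \oo).
  apply: cauchy_exP => e e0.
  have [k /(_ k (leqnn k)) hk] := half_expn_small (2 * C) e0.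
  exists (u k); exists k => // n /= kn; rewrite -ball_normE /= distrC.
  apply: le_lt_trans hk; rewrite -(subnK kn).
  apply: le_trans (far _ _) _; rewrite ler_wpM2l ?mulr_ge0// gerBl; exact: ltW.
have ucv : u @ \oo --> lim (u @ \oo) by exact: bE cu.
move: (lim _) ucv => l /cvgrPdist_lt ul; exists l, (2 * C) => k; apply/ler_addgt0Pr => e e0.
have [m _ hm] := ul _ e0; have := hm (m + k)%N (leq_addr _ _).
have := far m k; have := ler_distD (u (m + k)%N) (u k) l.
rewrite (distrC (u k) (u _)) (distrC l) /= => h1 h2 h3.
have := mulr_ge0 C0 (ltW (h0 (m + k)%N)); lra.
Qed.

Lemma closed_norm_closed (F : set E) : closed F -> norm_closed normr_on F.
Proof.
move=> clF x xF; apply: clF => A /nbhs_normP[e /= e0 eA].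
by have [y Fy yx] := xF _ e0; exists y; split=> //; apply: eA; rewrite /= distrC.
Qed.

Lemma asplund_frechet_dense : asplund E -> frechet_dense normr_on.
Proof.
move=> [_ AE] p pconv plip x e e0.
have pcont : continuous (p : E -> R^o).
  move=> y; apply/cvgrPdist_lt => d d0; apply/nbhs_normP; exists d => //= t yt.
  have h1 : p y - p t <= `|y - t| := plip y t.
  have h2 : p t - p y <= `|y - t| by rewrite distrC; exact: plip.
  by rewrite /= in yt *; rewrite ltr_norml; lra.
have convT : convex_set (setT : set (convex_lmodType E)).
  by move=> ? ? ? _ _; rewrite inE.
have convp : @convex_function R E setT p.
  by move=> t a b _ _; apply: pconv; apply/andP; split.
have [y [[_ dy] xy]] := AE setT p openT convT (continuous_subspaceT pcont) convp
  x I _ (nbhsx_ballx x e e0).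
exists y; first by move: xy; rewrite -ball_normE /= distrC.
exists ('d p y); first by move=> k u v; rewrite linearP.
move=> d d0; have /eqaddoP/(_ d d0) := diff_locally dy.
move=> /nbhs_normP[r /= r0 rP]; exists r => // h hr.
have := rP h; rewrite /= sub0r normrN => /(_ hr).
rewrite !fctE /= opprD addrA (addrC h); exact.
Qed.

Lemma dual_space_bounded (f : E -> R) : dual_space f ->
  exists2 M, 0 <= M & forall x, `|f x| <= M * `|x|.
Proof.
move=> [lf cf].
have [d d0 dP] : exists2 d, 0 < d & forall x, `|x| < d -> `|f x| < 1.
  have /cvgrPdist_lt/(_ 1 ltr01)/nbhs_normP[d /= d0 dP] := cf 0.
  exists d => // x xd; have := dP x; rewrite /= sub0r normrN => /(_ xd).
  by rewrite (linf0 lf) sub0r normrN.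
exists (2 / d); first by rewrite divr_ge0// ltW.
move=> x; have [->|x0] := eqVneq x 0; first by rewrite (linf0 lf) !normr0 mulr0.
have nx : 0 < `|x| by rewrite normr_gt0.
pose t := d / 2 / `|x|; have t0 : 0 < t by rewrite !divr_gt0.
have := dP (t *: x); rewrite normrZ (gtr0_norm t0) divfK ?gt_eqF//.
move=> /(_ ltac:(lra)); rewrite (linfZ lf) normrM (gtr0_norm t0) => h.
apply: ltW; rewrite -(ltr_pM2l t0); apply: lt_le_trans h _.
suff -> : t * (2 / d * `|x|) = 1 by [].
by rewrite /t; field; rewrite !gt_eqF.
Qed.

Lemma dual_norm_ub (f : E -> R) x : dual_space f -> `|f x| <= dual_norm f * `|x|.
Proof.
move=> df; have [lf _] := df; have [M M0 MP] := dual_space_bounded df.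
have [->|x0] := eqVneq x 0; first by rewrite (linf0 lf) !normr0 mulr0.
have nx : 0 < `|x| by rewrite normr_gt0.
rewrite -ler_pdivrMr//; apply: ub_le_sup.
  exists M => _ [y /= y1 <-]; apply: le_trans (MP y) _.
  by rewrite -[leRHS]mulr1 ler_wpM2l.
exists (`|x|^-1 *: x) => /=.
  by rewrite normrZ normfV normr_id mulVf// gt_eqF.
by rewrite (linfZ lf) normrM normfV normr_id mulrC.
Qed.

Lemma dual_norm_le (f : E -> R) M : 0 <= M -> (forall x, `|f x| <= M * `|x|) ->
  dual_norm f <= M.
Proof.
move=> M0 fM; apply: ge_sup; first by exists `|f 0|, 0 => //=; rewrite normr0.
move=> _ [y /= y1 <-]; apply: le_trans (fM y) _.
by rewrite -[leRHS]mulr1 ler_wpM2l.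
Qed.

Lemma frechet_normalP (Om : set E) (y : E) (f : E -> R) : dual_space f ->
  frechet_normal Om y f <-> normal_to normr_on Om y f.
Proof.
move=> df; have [lf _] := df; split.
  move=> [_ fe] e e0.
  have /ereal_inf_lt[_ [A yA <-] Ae] : (limf_esup (fun z : E => (f (z - y) / `|z - y|)%:E)
      (within Om y^') < e%:E)%E by apply: le_lt_trans fe _; rewrite lte_fin.
  move: yA => /nbhs_normP[d /= d0 dA]; exists d => // w Ow wy.
  have [->|wny] := eqVneq w y; first by rewrite subrr (linf0 lf) /= normr0 mulr0.
  have nw : 0 < `|w - y| by rewrite normr_gt0 subr_eq0.
  rewrite /= -ler_pdivrMr// -lee_fin; apply: le_trans (ltW Ae).
  apply: ereal_sup_ubound; exists w => //; apply: dA => //=; by rewrite distrC.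
move=> nf; split=> //; apply/lee_addgt0Pr => e e0; rewrite add0e.
apply: ge_ereal_inf; have [d d0 dP] := nf _ e0.
exists (ereal_sup ((fun z : E => (f (z - y) / `|z - y|)%:E) @`
    [set z | f (z - y) / `|z - y| <= e])); last first.
  by apply: ge_ereal_sup => _ [z /= ze <-]; rewrite lee_fin.
exists [set z | f (z - y) / `|z - y| <= e] => //.
apply/nbhs_normP; exists d => //= z yz zny Oz.
rewrite ler_pdivrMr ?normr_gt0 ?subr_eq0//; apply: dP => //.
by rewrite /= distrC.
Qed.

End NormedModule.

Lemma frechet_dense_equiv (R : realType) (V : lmodType R) (N G : norm_on V) K :
  0 < K -> (forall v, G v <= N v) -> (forall v, N v <= K * G v) ->
  frechet_dense N -> frechet_dense G.
Proof.
move=> K0 GN NG AN p pconv plip x e e0.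
have [|y yx [f lf yf]] := AN p pconv _ x e e0.
  by move=> u v; apply: le_trans (GN _).
exists y; first exact: le_lt_trans (GN _) yx.
exists f => // d d0; have [r r0 rP] := yf _ (divr_gt0 d0 K0).
exists (r / K); first by rewrite divr_gt0.
move=> h; rewrite ltr_pdivlMr// mulrC => hr.
apply: le_trans (rP h (le_lt_trans (NG _) hr)) _.
rewrite -mulrA; apply: ler_wpM2l; first exact: ltW.
by rewrite ler_pdivrMl.
Qed.

(** * Functionals on the product space and necessity *)

Section DualMore.
Variables (R : realType) (E : normedModType R).

Lemma bounded_dual_space (f : E -> R) M : scalar f ->
  (forall x, `|f x| <= M * `|x|) -> dual_space f.
Proof.
move=> lf fM; split=> // x; apply/cvgrPdist_lt => e e0.
have M0 : 0 < `|M| + 1 by rewrite ltr_wpDl.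
apply/nbhs_normP; exists (e / (`|M| + 1)); first by rewrite /= divr_gt0.
move=> y /=; rewrite ltr_pdivlMr// => xy; rewrite -(linfB lf).
apply: le_lt_trans (fM _) _; apply: le_lt_trans xy.
rewrite mulrC ler_wpM2l//; have := ler_norm M; lra.
Qed.

Lemma dual_norm_ge0 (f : E -> R) : dual_space f -> 0 <= dual_norm f.
Proof.
move=> df; have [M M0 fM] := dual_space_bounded df.
apply: le_trans (normr_ge0 (f 0)) _; apply: ub_le_sup; last first.
  by exists 0 => //=; rewrite normr0.
exists M => _ [y /= y1 <-]; apply: le_trans (fM y) _.
by rewrite -[leRHS]mulr1 ler_wpM2l.
Qed.

Lemma dual_spaceZ (f : E -> R) c : dual_space f -> dual_space (fun x => c * f x).
Proof.
move=> df; have [lf _] := df; have [M M0 fM] := dual_space_bounded df.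
apply: (@bounded_dual_space _ (`|c| * M)) => [k u v|x].
  by rewrite lf mulrDr mulrCA.
by rewrite normrM -mulrA ler_wpM2l.
Qed.

Lemma dual_normZ (f : E -> R) c : dual_space f -> 0 < c ->
  dual_norm (fun x => c * f x) = c * dual_norm f.
Proof.
move=> df c0; have dcf := dual_spaceZ c df.
apply/eqP; rewrite eq_le; apply/andP; split.
  apply: dual_norm_le; first by rewrite mulr_ge0 ?dual_norm_ge0// ltW.
  move=> x; rewrite normrM (gtr0_norm c0) -mulrA ler_pM2l//.
  exact: dual_norm_ub.
rewrite mulrC -ler_pdivlMr//; apply: dual_norm_le.
  by rewrite divr_ge0 ?dual_norm_ge0// ltW.
move=> x; rewrite mulrAC ler_pdivlMr// mulrC -[c in leLHS](gtr0_norm c0) -normrM.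
exact: dual_norm_ub dcf.
Qed.

End DualMore.

Section ProductSpace.
Variables (R : realType) (n : nat) (X : normedModType R).
Variable N : norm_on ('I_n -> X).

Definition diag (v : X) : 'I_n -> X := fun=> v.
Definition single (i : 'I_n) (v : X) : 'I_n -> X := fun j => if j == i then v else 0.

Lemma diagD u v : diag (u + v) = diag u + diag v. Proof. by []. Qed.
Lemma diagZ k v : diag (k *: v) = k *: diag v. Proof. by []. Qed.
Lemma diagN v : diag (- v) = - diag v. Proof. by []. Qed.

Lemma sum_single (x : 'I_n -> X) : x = \sum_i single i (x i).
Proof.
apply/funext => j; rewrite fct_sumE (bigD1 j) //= {1}/single eqxx big1 ?addr0//.
by move=> i ij; rewrite /single eq_sym (negbTE ij).
Qed.

Lemma linf_sum (V : lmodType R) (f : V -> R) (I : Type) (r : seq I) (F : I -> V) :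
  scalar f -> f (\sum_(i <- r) F i) = \sum_(i <- r) f (F i).
Proof.
move=> lf; elim: r => [|i r IH]; first by rewrite !big_nil (linf0 lf).
by rewrite !big_cons (linfD lf) IH.
Qed.

Lemma tuple_functional_single (a : ('I_n -> X) -> R) : scalar a ->
  tuple_functional (fun i v => a (single i v)) = a.
Proof.
by move=> la; apply/funext => x; rewrite [in RHS](sum_single x) linf_sum.
Qed.

Variable kappa : R.
Hypothesis kappa0 : 0 < kappa.
Hypothesis Nkappa : forall u : 'I_n -> X, N u <= kappa * \big[Num.max/0]_(i < n) `|u i|.

Lemma norm_diag v : N (diag v) <= kappa * `|v|.
Proof.
apply: le_trans (Nkappa _) _; rewrite ler_pM2l//.
by apply: bigmax_le.
Qed.

Lemma norm_single i v : N (single i v) <= kappa * `|v|.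
Proof.
apply: le_trans (Nkappa _) _; rewrite ler_pM2l//.
by apply: bigmax_le => // j _; rewrite /single; case: eqP; rewrite ?normr0.
Qed.

Variable Om : 'I_n -> set X.
Local Notation Omh := (prod_set Om).

(** The increment used at the end is [h = t *: u + (w, ..., w)], where [f]
  nearly attains its norm at [u], [t] is just below [alpha * rho] and [w] is
  provided by transversality. *)
Lemma transversal_dual_ineq xbar alpha : 0 < alpha ->
  alpha_transversal N Om xbar alpha ->
  exists2 eps, 0 < eps & forall (x : 'I_n -> X) (xs : 'I_n -> X -> R),
      Omh x -> (forall i, dual_space (xs i)) ->
      @frechet_normal R (normed_by N) Omh x (tuple_functional xs) ->
      N (fun i => x i - xbar) < eps ->
      @dual_norm R (normed_by N) (tuple_functional xs) = 1 ->
      alpha / 2 < dual_norm (\sum_(i < n) xs i).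
Proof.
have k0 := kappa0.
move=> al0 [eps eps0 tr]; exists eps => // x xs Ox dxs fn xe n1.
have [df _] := fn; have [lf _] := df.
have /(frechet_normalP _ _ df) nf := fn.
rewrite ltNge; apply/negP => small.
set S := dual_norm _ in small.
have dS : dual_space (\sum_(i < n) xs i).
  have /choice[M MP] : forall i, exists M, forall v, `|xs i v| <= M * `|v|.
    by move=> i; have [M _ MP] := dual_space_bounded (dxs i); exists M.
  apply: (@bounded_dual_space _ _ _ (\sum_i M i)) => [k u v|v]; rewrite !fct_sumE.
    rewrite mulr_sumr -big_split; apply: eq_bigr => i _.
    by have [li _] := dxs i; rewrite li.
  by rewrite mulr_suml; apply: le_trans (ler_norm_sum _ _ _) _; apply: ler_sum.
(* With this tolerance the errors use up only half of the gap between
   [alpha] and [alpha / 2]. *)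
pose eta := alpha / (4 * (3 * alpha + kappa)).
have K0 : 0 < 4 * (3 * alpha + kappa) by rewrite mulr_gt0// addr_gt0// mulr_gt0.
have eta0 : 0 < eta by rewrite divr_gt0.
have etaE : eta * (3 * alpha + kappa) = alpha / 4 by rewrite /eta; field; rewrite gt_eqF// addr_gt0// mulr_gt0.
have eta1 : eta < 1 by rewrite ltr_pdivrMr//; lra.
have [u u1 fu] : exists2 u, N u <= 1 & 1 - eta < tuple_functional xs u.
  have : has_sup [set `|tuple_functional xs x| | x in [set x : normed_by N | `|x| <= 1]].
    split; first by exists `|tuple_functional xs 0|, 0 => //=; rewrite normr0.
    exists 1 => _ [y /= y1 <-]; have := @dual_norm_ub R (normed_by N) _ y df.
    by rewrite [X in X * _]n1 mul1r => /le_trans; apply.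
  move=> /(sup_adherent eta0)[_ [/= u u1 <-]]; have {}u1 : N u <= 1 := u1; rewrite [sup _](_ : _ = 1)// => fu.
  have [h|h] := leP 0 (tuple_functional xs u).
    by exists u => //; rewrite ger0_norm in fu.
  exists (- (u : 'I_n -> X)); first by rewrite norm_onN.
  by rewrite (linfN lf) -(ltr0_norm h).
have [d d0 dP] := nf _ eta0.
have aK : 0 < alpha + kappa by lra.
pose rho := Num.min (eps / 2) (d / 2 / (alpha + kappa)).
have rho0 : 0 < rho by rewrite lt_min !divr_gt0.
have rhoe : rho < eps.
  by apply: le_lt_trans (_ : eps / 2 < _); [rewrite ge_min lexx|lra].
have rhod : (alpha + kappa) * rho < d.
  apply: le_lt_trans (_ : d / 2 < _); last by lra.
  by rewrite mulrC -ler_pdivlMr// ge_min lexx orbT.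
pose t := alpha * rho * (1 - eta).
have ar0 : 0 < alpha * rho by rewrite mulr_gt0.
have t0 : 0 < t by rewrite mulr_gt0//; lra.
have tlt : t < alpha * rho by rewrite gtr_pMr//; lra.
have Na : N (t *: u) <= t by rewrite (norm_onZp _ _ (ltW t0)) ger_pMr.
have [w [/= wP]] := tr rho x (t *: u) ltac:(lra) Ox xe (le_lt_trans Na tlt).
rewrite -ball_normE /= sub0r normrN => wr.
pose h : 'I_n -> X := t *: u + diag w.
have Ozh : Omh (x + h).
  move=> i; have [y Oy yw] := wP i I.
  suff -> : (x + h) i = y by [].
  rewrite /h !fctE /diag -yw.
  by rewrite [_ + (y - _ - _)]addrC subrK addrC subrK.
have Nh : N h <= (alpha + kappa) * rho.
  have := norm_onD N (t *: u) (diag w); have := norm_diag w.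
  have : kappa * `|w| <= kappa * rho by rewrite ler_pM2l// ltW.
  by rewrite -/h; lra.
have := dP (x + h) Ozh; rewrite (addrC x) addrK => /(_ (le_lt_trans Nh rhod)).
have -> : tuple_functional xs h = t * tuple_functional xs u + (\sum_(i < n) xs i) w.
  by rewrite (linfD lf) (linfZ lf) fct_sumE.
have := dual_norm_ub w dS; rewrite ler_norml => /andP[+ _].
have : S * `|w| <= alpha / 2 * rho.
  by apply: ler_pM; rewrite ?dual_norm_ge0// ltW.
have : t * (1 - eta) <= t * tuple_functional xs u by rewrite ler_pM2l// ltW.
have : eta * N h <= eta * ((alpha + kappa) * rho) by rewrite ler_pM2l.
rewrite -/S => q1 q2 q3 q4 q5.
have : alpha * rho * (1 - eta) * (1 - eta) - alpha / 2 * rho <= eta * ((alpha + kappa) * rho).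
  have {}q5 : t * tuple_functional xs u + (\sum_(i < n) xs i) w <= eta * N h := q5.
  by rewrite -/t; lra.
have : 0 <= alpha * rho * eta ^+ 2 by rewrite mulr_ge0 ?sqr_ge0 ?ltW.
have : eta * (3 * alpha + kappa) * rho = alpha / 4 * rho by rewrite etaE.
lra.
Qed.
End ProductSpace.

(** * From the dual inequality to transversality *)

Section TiltedNorm.
Variables (R : realType) (n : nat) (X : normedModType R).
Variable N : norm_on ('I_n -> X).
Variables (kappa al : R).
Hypothesis kappa0 : 0 < kappa.
Hypothesis al0 : 0 < al.
Hypothesis N_diag : forall v : X, N (diag v) <= kappa * `|v|.

Definition tilt (y : 'I_n -> X) : R :=
  inf [set N (y - diag u) + al * `|u| | u in setT].

Lemma tilt_lb (y : 'I_n -> X) : has_lbound [set N (y - diag u) + al * `|u| | u in setT].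
Proof.
exists 0 => _ [u _ <-]; rewrite addr_ge0 ?norm_on_ge0//.
by rewrite mulr_ge0// ltW.
Qed.

Lemma tilt_le y u : tilt y <= N (y - diag u) + al * `|u|.
Proof. by apply: ge_inf; [exact: tilt_lb|exists u]. Qed.

Lemma tilt_adherent y e : 0 < e -> exists u, N (y - diag u) + al * `|u| < tilt y + e.
Proof.
move=> e0; have [|_ [u _ <-] ue] := inf_adherent (E := [set N (y - diag u) + al * `|u| | u in setT]) e0.
  by split; [exists (N (y - diag 0) + al * `|0 : X|), 0|exact: tilt_lb].
by exists u.
Qed.

Lemma tilt_le_norm y : tilt y <= N y.
Proof. by have := tilt_le y 0; rewrite normr0 mulr0 addr0 subr0. Qed.

Lemma tilt_diag v : tilt (diag v) <= al * `|v|.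
Proof. by have := tilt_le (diag v) v; rewrite subrr norm_on0 add0r. Qed.

Lemma norm_le_tilt y : N y <= (1 + kappa / al) * tilt y.
Proof.
have K0 : 0 < 1 + kappa / al by rewrite addr_gt0// divr_gt0.
apply/ler_addgt0Pr => e e0.
have [u] := tilt_adherent y (divr_gt0 e0 K0).
rewrite -(ltr_pM2l K0) [ltRHS]mulrDr [X in _ < _ + X]mulrC divfK ?gt_eqF// => h.
have := norm_onB N y (diag u); have := N_diag u; rewrite addrC => h1 h2.
have : 0 <= kappa / al * N (y - diag u) by rewrite mulr_ge0 ?norm_on_ge0// ltW// divr_gt0.
have : kappa / al * (al * `|u|) = kappa * `|u| by rewrite mulrA divfK// gt_eqF.
have : 0 <= al * `|u| by rewrite mulr_ge0// ltW.
lra.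
Qed.

Lemma tiltD y z : tilt (y + z) <= tilt y + tilt z.
Proof.
apply/ler_addgt0Pr => e e0; have e2 : 0 < e / 2 by lra.
have [u yu] := tilt_adherent y e2; have [v zv] := tilt_adherent z e2.
have := tilt_le (y + z) (u + v).
have := norm_onD N (y - diag u) (z - diag v).
rewrite addrACA -opprD -diagD.
have := ler_wpM2l (ltW al0) (ler_normD u v); lra.
Qed.

Lemma tiltZ_le k y : tilt (k *: y) <= `|k| * tilt y.
Proof.
apply/ler_addgt0Pr => e e0.
have k0 : 0 < `|k| + 1 by rewrite ltr_wpDl.
have [u] := tilt_adherent y (divr_gt0 e0 k0).
rewrite -(ltr_pM2l k0) [ltRHS]mulrDr [X in _ < _ + X]mulrC divfK ?gt_eqF// => h.
have := tilt_le (k *: y) (k *: u); rewrite diagZ -scalerBr norm_onZ normrZ.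
have := tilt_le y u; lra.
Qed.

Lemma tilt0 : tilt 0 = 0.
Proof.
apply/eqP; rewrite eq_le -{1}(norm_on0 N) tilt_le_norm /=.
by have := norm_le_tilt 0; rewrite norm_on0 pmulr_rge0// addr_gt0// divr_gt0.
Qed.

Lemma tiltZ k y : tilt (k *: y) = `|k| * tilt y.
Proof.
have [->|k0] := eqVneq k 0; first by rewrite scale0r normr0 mul0r tilt0.
apply/eqP; rewrite eq_le tiltZ_le /=.
have nk : 0 < `|k| by rewrite normr_gt0.
by have := tiltZ_le k^-1 (k *: y); rewrite scalerK// normfV ler_pdivlMl.
Qed.

Lemma tilt_eq0 y : tilt y = 0 -> y = 0.
Proof.
move=> y0; apply: (norm_on0_eq0 (n := N)); apply/eqP; rewrite eq_le norm_on_ge0 andbT.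
by have := norm_le_tilt y; rewrite y0 mulr0.
Qed.

(** A functional of [N]-norm at most 1 is in its dual ball if and only if its
  restriction to the diagonal, which is the sum of its components, has norm
  at most [al]. *)
Definition tilted_norm : norm_on ('I_n -> X) := NormOn tiltD tiltZ tilt_eq0.

End TiltedNorm.

Section Backward.
Variables (R : realType) (n : nat) (X : normedModType R).
Variable N : norm_on ('I_n -> X).
Variables (kappa al : R).
Hypothesis kappa0 : 0 < kappa.
Hypothesis al0 : 0 < al.
Hypothesis Nkappa : forall u : 'I_n -> X, N u <= kappa * \big[Num.max/0]_(i < n) `|u i|.
Variable Om : 'I_n -> set X.
Local Notation Omh := (prod_set Om).

(** Normalizing [a], whose norm is at least 1/2 because of its value at [h],
  at most doubles the norm of the sum of its components. *)
Lemma small_sum_normal x a h : Omh x -> dual_ball N a -> normal_to N Omh x a ->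
  (forall v, a (diag v) <= al * `|v|) -> 0 < N h -> N h <= 2 * a h ->
  exists xs : 'I_n -> X -> R, [/\ forall i, dual_space (xs i),
    @frechet_normal R (normed_by N) Omh x (tuple_functional xs),
    @dual_norm R (normed_by N) (tuple_functional xs) = 1 &
    dual_norm (\sum_(i < n) xs i) <= 2 * al].
Proof.
move=> Ox Ba na aal Nh ah; have [la aN] := Ba.
have aN' v : `|a v| <= N v by rewrite ler_norml (dual_ballN v Ba) aN.
have da : @dual_space R (normed_by N) a.
  by apply: (@bounded_dual_space R (normed_by N) a 1) => // v; rewrite mul1r; exact: aN'.
pose m := @dual_norm R (normed_by N) a.
have m2 : 1 / 2 <= m.
  rewrite -(ler_pM2r Nh).
  have := ler_norm (a h).
  have : `|a h| <= m * N h := @dual_norm_ub R (normed_by N) a h da.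
  lra.
have m0 : 0 < m by apply: lt_le_trans m2; lra.
have mV : 0 < m^-1 by rewrite invr_gt0.
pose xs i v := m^-1 * a (single i v).
have xsE : tuple_functional xs = fun y => m^-1 * a y.
  by apply/funext => y; rewrite -[in RHS](tuple_functional_single la) /tuple_functional mulr_sumr.
exists xs; split.
- move=> i; apply: dual_spaceZ.
  apply: (@bounded_dual_space _ _ _ kappa) => [k u v|v].
    rewrite -la; congr (a _); apply/funext => j; rewrite !fctE /single.
    by case: eqP => //; rewrite scaler0 addr0.
  by apply: le_trans (aN' _) _; exact: norm_single.
- rewrite xsE; apply/frechet_normalP; first exact: (@dual_spaceZ R (normed_by N)).
  move=> e e0; have [d d0 dP] := na _ (mulr_gt0 m0 e0); exists d => // w Ow wx.
  by rewrite ler_pdivrMl// mulrA; exact: dP.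
- by rewrite xsE (@dual_normZ R (normed_by N))// mulVf// gt_eqF.
have SE v : (\sum_(i < n) xs i) v = m^-1 * a (diag v).
  by rewrite -(tuple_functional_single la) /tuple_functional mulr_sumr fct_sumE.
apply: dual_norm_le => [|v]; first by rewrite mulr_ge0// ltW.
rewrite SE normrM (gtr0_norm mV) ler_pdivrMl//.
have : `|a (diag v)| <= al * `|v|.
  rewrite ler_norml aal andbT lerNl -(linfN la).
  by have := aal (- v); rewrite normrN diagN.
move=> /le_trans; apply; rewrite mulrA ler_wpM2r// mulrA.
by rewrite -[leLHS]mul1r; apply: ler_wpM2r; [exact: ltW|lra].
Qed.


Hypothesis AN : frechet_dense N.
Hypothesis cN : geom_complete N.
Hypothesis clO : norm_closed N Omh.

Definition has_small_sum_normal (x : 'I_n -> X) := exists xs : 'I_n -> X -> R,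
  [/\ forall i, dual_space (xs i),
    @frechet_normal R (normed_by N) Omh x (tuple_functional xs),
    @dual_norm R (normed_by N) (tuple_functional xs) = 1 &
    dual_norm (\sum_(i < n) xs i) <= 2 * al].

Local Notation K := (1 + kappa / al).

(** In the near optimal decomposition of [y - b], either the part off the
  diagonal is at most [tau / 2], and [b + diag u] is the new centre; or it is
  so large that a functional nearly attaining [G (b - y)] has [N]-norm at
  least 1/2. *)
Lemma recentering_step b x tau : 0 < tau -> Omh x -> ~ Omh b -> N (x - b) <= tau ->
  (forall y, Omh y -> N (y - x) <= (2 * K + 1) * tau -> ~ has_small_sum_normal y) ->
  exists u y, [/\ Omh y, al * `|u| <= 4 * tau, N (y - b - diag u) <= tau / 2 &
    N (y - x) <= (2 * K + 1) * tau].
Proof.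
move=> tau0 Ox nOb xb nobad.
have Nd := norm_diag kappa0 Nkappa.
pose G := tilted_norm kappa0 al0 Nd.
have K0 : 0 < K by rewrite addr_gt0// divr_gt0.
have GN v : G v <= N v := tilt_le_norm N al0 v.
have NG v : N v <= K * G v := norm_le_tilt kappa0 al0 Nd v.
have AG : frechet_dense G := frechet_dense_equiv K0 GN NG AN.
have cG : geom_complete G.
  move=> u C uC; have [|l [C' uC']] := cN (u := u) (C := K * C).
    by move=> k; apply: le_trans (NG _) _; rewrite -mulrA ler_pM2l.
  by exists l, C' => k; apply: le_trans (GN _) _.
have clG : norm_closed G Omh.
  move=> y yO; apply: clO => e e0; have [z Oz zy] := yO _ (divr_gt0 e0 K0).
  by exists z => //; apply: le_lt_trans (NG _) _; rewrite mulrC -ltr_pdivlMr.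
have [y [a [Oy Ba yb ab na]]] := norming_normal AG cG clG Ox nOb.
have g0 : 0 < G (y - b).
  rewrite lt_neqAle norm_on_ge0 andbT eq_sym; apply/negP => /eqP /norm_on0_eq0.
  by move=> /subr0_eq yb0; rewrite yb0 in Oy.
have yx : N (y - x) <= (2 * K + 1) * tau.
  have := norm_on_tri N b y x; rewrite (norm_onBC N b x); have := NG (y - b).
  have : K * G (y - b) <= K * (2 * tau).
    by rewrite ler_pM2l//; have := GN (x - b); lra.
  lra.
have e0 : 0 < G (y - b) / 16 by lra.
have [u yu] := tilt_adherent N al0 (y - b) e0.
have {}yu : N (y - b - diag u) + al * `|u| < G (y - b) + G (y - b) / 16 := yu.
have alu : 0 <= al * `|u| by rewrite mulr_ge0// ltW.
have := norm_on_ge0 N (y - b - diag u) => Ny.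
have := GN (x - b) => Gxb.
have [small|big] := leP (N (y - b - diag u)) (tau / 2).
  by exists u, y; split=> //; lra.
case: (nobad y Oy yx); have [la aG] := Ba.
have adiag v : a (diag v) <= al * `|v|.
  by apply: le_trans (aG _) _; exact: (tilt_diag N al0).
apply: (small_sum_normal (a := a) (h := - (y - b - diag u)) Oy _ _ adiag).
- by split=> // v; apply: le_trans (aG v) _.
- move=> e e1; have [d d0 dP] := na _ e1; exists d => // w Ow wd.
  apply: le_trans (dP _ Ow (le_lt_trans (GN _) wd)) _.
  by apply: ler_wpM2l; [exact: ltW|exact: GN].
- by rewrite norm_onN; lra.
have {}ab : 15 / 16 * G (y - b) <= - a (y - b).
  by rewrite -(linfN la) opprB (norm_onBC G y).
rewrite norm_onN (linfN la) (linfB la (y - b)).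
have := adiag (- u); rewrite diagN (linfN la) normrN; lra.
Qed.

Hypothesis bX : geom_complete (normr_on X).

(** Iterate [recentering_step].  The shifts of the centre are at most
  [rho / 4 * 2^-k], so that their sum stays within [rho / 2]: every centre is
  outside the product set, as the next step requires, and so would be the
  limit of the centres, which is also the limit of the points. *)
Lemma transversal_core (x a : 'I_n -> X) rho : 0 < rho -> Omh x ->
  N a < al / 16 * rho ->
  (forall y, Omh y -> N (y - x) <= (2 * K + 1) * (al / 8 * rho) -> ~ has_small_sum_normal y) ->
  exists2 v, `|v| < rho & Omh (x + a + diag v).
Proof.
move=> rho0 Ox Na nobad; apply: contrapT => nov.
have a0 := al0.
pose b := x + a; pose tau := al / 16 * rho.
have tau0 : 0 < tau by rewrite !mulr_gt0// invr_gt0.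
have nOb v : `|v| < rho -> ~ Omh (b + diag v) by move=> vr Ov; apply: nov; exists v.
pose hf k : R := 2^-1 ^+ k.
have h0 k : 0 < hf k by rewrite exprn_gt0.
have hS k : hf k.+1 = hf k / 2 by rewrite /hf exprSr.
have K0 : 0 < 2 * K + 1 by rewrite addr_gt0// mulr_gt0// addr_gt0// divr_gt0.
pose inv k (s : X * ('I_n -> X)) := [/\ Omh s.2, `|s.1| <= rho / 2 * (1 - hf k),
  N (s.2 - b - diag s.1) <= tau * hf k &
  N (s.2 - x) <= (2 * K + 1) * (2 * tau) * (1 - hf k)].
have /choice[next nextP] : forall ks : nat * (X * ('I_n -> X)), exists s,
    inv ks.1 ks.2 -> inv ks.1.+1 s /\ `|s.1 - ks.2.1| <= rho / 4 * hf ks.1.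
  move=> [k [v y]] /=; have [[/= Oy vr yb yx]|ni] := pselect (inv k (v, y)); last first.
    by exists (v, y) => /ni.
  have hk1 : hf k <= 1 by rewrite exprn_ile1//; lra.
  have th0 : 0 < tau * hf k by rewrite mulr_gt0.
  have vrho : `|v| < rho.
    by have := mulr_gt0 rho0 (h0 k); lra.
  have yb' : N (y - (b + diag v)) <= tau * hf k by rewrite opprD addrA.
  have [|u [z [Oz ut zb zy]]] := recentering_step th0 Oy (nOb v vrho) yb'.
    move=> z Oz zy; apply: nobad => //.
    have := norm_on_tri N y z x.
    have := mulr_gt0 K0 th0.
    by have : al / 8 * rho = 2 * tau; [rewrite /tau; lra|move=> ->; lra].
  have ur : `|u| <= rho / 4 * hf k.
    by rewrite -(ler_pM2l al0); apply: le_trans ut _; rewrite /tau; lra.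
  exists (v + u, z) => _; split; last by rewrite /= addrC addKr.
  split=> //=; rewrite hS.
  - by have := ler_normD v u; lra.
  - by rewrite diagD (opprD (diag v)) addrA; move: zb; rewrite (opprD b) addrA; lra.
  - by have := norm_on_tri N y z x; lra.
pose s := fix s k := if k is k'.+1 then next (k', s k') else (0, x).
have sinv k : inv k (s k).
  elim: k => [|k IH]; last exact: (nextP (k, s k) IH).1.
  split=> //=; rewrite /hf expr0 ?subrr ?mulr0 ?normr0 ?norm_on0// mulr1.
  by rewrite [diag _](_ : _ = 0)// subr0 /b opprD addNKr norm_onN ltW.
have sstep k : `|(s k.+1).1 - (s k).1| <= rho / 4 * hf k := (nextP (k, s k) (sinv k)).2.
have [v [C vP]] := bX (u := fun k => (s k).1) sstep.
have vr : `|v| <= rho / 2.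
  apply/ler_addgt0Pr => e e0; have [k /(_ k (leqnn k)) hk] := half_expn_small C e0.
  have := vP k; rewrite /= distrC => hv.
  have [_ + _ _] := sinv k; have := mulr_gt0 rho0 (h0 k).
  have := ler_normD (s k).1 (v - (s k).1); rewrite addrC subrK -/(hf k) in hk *.
  rewrite -/(hf k) in hv; lra.
apply: (nOb v); first by lra.
apply: clO => e e0; have [k /(_ k (leqnn k)) hk] := half_expn_small (tau + kappa * C) e0.
exists (s k).2; first by case: (sinv k).
have [_ _ + _] := sinv k.
have := norm_diag kappa0 Nkappa ((s k).1 - v).
have := vP k; rewrite -(ler_pM2l kappa0) -/(hf k) => h1 h2 h3.
have -> : (s k).2 - (b + diag v) = ((s k).2 - b - diag (s k).1) + diag ((s k).1 - v).
  by rewrite diagD diagN addrA subrK opprD addrA.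
apply: le_lt_trans (norm_onD _ _ _) _; rewrite -/(hf k) in hk.
rewrite /= in h1; lra.
Qed.

End Backward.

Theorem corollary4p7 (R : realType) (n : nat) (n_gt1 : (1 < n)%N)
    (X : normedModType R) (N : norm_on ('I_n -> X))
    (asplundX : asplund X) (asplundXn : asplund (normed_by N))
    (N_le_max : exists2 kappa : R, 0 < kappa &
       forall u : 'I_n -> X, N u <= kappa * \big[Num.max/0]_(i < n) `|u i|)
    (Om : 'I_n -> set X) (Om_neq0 : forall i, Om i !=set0)
    (Om_closed : closed (prod_set Om : set (normed_by N)))
    (xbar : X) (Om_xbar : forall i, Om i xbar) :
  transversal_at N Om xbar <->
  exists alpha eps : R, [/\ 0 < alpha, 0 < eps &
    forall (x : 'I_n -> X) (xs : 'I_n -> X -> R),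
      prod_set Om x ->
      (forall i, dual_space (xs i)) ->
      @frechet_normal R (normed_by N) (prod_set Om) x (tuple_functional xs) ->
      N (fun i => x i - xbar) < eps ->
      @dual_norm R (normed_by N) (tuple_functional xs) = 1 ->
      alpha < dual_norm (\sum_(i < n) xs i)].
Proof.
have [kappa kappa0 Nkappa] := N_le_max; split.
  move=> [alpha al0 tr].
  have [eps eps0 dual] := transversal_dual_ineq kappa0 Nkappa al0 tr.
  by exists (alpha / 2), eps; split=> //; rewrite divr_gt0.
move=> [alpha [eps [alpha0 eps0 dual]]].
pose al := alpha / 2; have al0 : 0 < al by rewrite divr_gt0.
have AN : frechet_dense N := asplund_frechet_dense asplundXn.
have cN : geom_complete N := banach_geom_complete asplundXn.1.
have clO : norm_closed N (prod_set Om) := closed_norm_closed Om_closed.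
have bX := banach_geom_complete asplundX.1.
pose K : R := (2 * (1 + kappa / al) + 1) * (al / 8) + 1.
have K1 : 1 <= K.
  by rewrite lerDr !mulr_ge0// ?addr_ge0 ?mulr_ge0 ?invr_ge0// ?addr_ge0 ?mulr_ge0 ?invr_ge0// ltW.
exists (al / 16); first by rewrite divr_gt0.
have K0 : 0 < K by lra.
exists (eps / K); first by rewrite divr_gt0.
move=> rho x a /andP[rho0 rhoe] Ox xe Na.
have [|v vr Ov] := transversal_core kappa0 al0 Nkappa AN cN clO bX rho0 Ox Na.
  move=> y Oy yx [xs [dxs fxs n1 small]].
  suff ye : N (fun i => y i - xbar) < eps.
    by have := dual _ _ Oy dxs fxs ye n1; rewrite /al in small; lra.
  have -> : (fun i => y i - xbar) = (y - x) + (fun i => x i - xbar).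
    by apply/funext => i; rewrite !fctE addrA subrK.
  apply: le_lt_trans (norm_onD _ _ _) _.
  have : (K - 1) * rho <= (K - 1) * (eps / K).
    by apply: ler_wpM2l; [rewrite subr_ge0|exact: ltW].
  have : K * (eps / K) = eps by rewrite mulrC divfK// gt_eqF.
  have -> : (K - 1) * rho = (2 * (1 + kappa / al) + 1) * (al / 8 * rho).
    by rewrite /K addrK -!mulrA.
  move: xe yx; move: (eps / K) (N _) => q p; lra.
exists v; split; last by rewrite -ball_normE /= sub0r normrN.
move=> i _; exists (x i + a i + v); first exact: Ov.
by rewrite /= -addrA -opprD addrC addKr.
Qed.
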